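(* Let $\mathfrak{a}$ be a nonzero proper ideal of $R=\mathcal{O}[1/\eta]$ with prime factorization $\mathfrak{a}=\mathfrak{p}_1^{e_1}\cdots\mathfrak{p}_r^{e_r}$ (distinct prime ideals $\mathfrak{p}_i$, $e_i\ge 1$). Then $\mathfrak{a}$ is of degree one if and only if both of the following hold: (i) for each $1\le i\le r$, $\mathfrak{p}_i$ is of degree one, and $e_i=1$ whenever $\mathfrak{p}_i$ is ramified; (ii) $\gcd(\mathfrak{N}(\mathfrak{p}_i),\mathfrak{N}(\mathfrak{p}_j))=1$ for all $1\le i<j\le r$. Furthermore, let $\alpha\in R$ satisfy $L=\mathbb{Q}(\alpha)$, let $f\in\mathbb{Z}[x]$ be the primitive minimal polynomial of $\alpha$ over $\mathbb{Z}$, and let $D_f$ be the discriminant of $f$. If $n\ge 2$ is an integer with $\gcd(n,\eta D_f)=1$, then the maps $v\mapsto (\alpha-v,n)R$ and $\mathfrak{a}\mapsto\alpha(\mathfrak{a})$ are mutually inverse bijections between the set $\{v\in\{0,1,\dots,n-1\}: f(v)\equiv 0 \pmod n\}$ and the set of ideals of $R$ of degree one with $\mathfrak{N}(\mathfrak{a})=n$.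
   Context: Let $L$ be a number field with ring of integers $\mathcal{O}$, let $\eta$ be a positive integer, and put $R=\mathcal{O}[1/\eta]$, $Z_\eta=\mathbb{Z}[1/\eta]$. For a nonzero ideal $\mathfrak{a}$ of $R$, $\mathfrak{N}(\mathfrak{a})=|R/\mathfrak{a}|$ is its absolute norm, and its inertia degree is $\mathfrak{i}(\mathfrak{a})=\log|R/\mathfrak{a}|/\log|Z_\eta/(\mathfrak{a}\cap Z_\eta)|$; $\mathfrak{a}$ is called of degree one if $\mathfrak{i}(\mathfrak{a})=1$, equivalently $R/\mathfrak{a}\cong Z_\eta/(\mathfrak{a}\cap Z_\eta)$. For a degree one ideal $\mathfrak{a}$ with $\mathfrak{N}(\mathfrak{a})=n$ and $\alpha\in R$, $\alpha(\mathfrak{a})$ denotes the unique integer in $[0,n)$ with $\alpha-\alpha(\mathfrak{a})\in\mathfrak{a}$. A prime ideal $\mathfrak{p}$ of $R$ with $\mathfrak{p}\cap Z_\eta=pZ_\eta$ ($p$ prime) is ramified if $\mathfrak{p}^2$ divides $pR$, unramified otherwise. $(x,y)R$ denotes the ideal of $R$ generated by $x,y$. *)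

(* Defs.v *)
From HB Require Import structures.
From mathcomp Require Import all_boot all_order all_algebra all_field.
From Stdlib Require Import ClassicalEpsilon.
Set Implicit Arguments. Unset Strict Implicit. Unset Printing Implicit Defensive.
Import Order.TTheory GRing.Theory Num.Theory.
Local Open Scope ring_scope.

Section NFDefs.
Variables (L : fieldExtType rat) (eta : nat).

Definition integralZ (x : L) : Prop :=
  exists p : {poly int}, p \is monic /\ (map_poly (fun z : int => z%:~R : L) p).[x] = 0.

Definition OL (x : L) : Prop := integralZ x.

Definition Rloc (x : L) : Prop := exists k : nat, OL ((eta%:R : L) ^+ k * x).

Definition Zeta (x : L) : Prop :=
  exists (z : int) (k : nat), x = z%:~R / (eta%:R : L) ^+ k.

Definition is_ideal (a : L -> Prop) : Prop :=
  [/\ (forall x, a x -> Rloc x), a 0,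
      (forall x y, a x -> a y -> a (x - y)) &
      (forall r x, Rloc r -> a x -> a (r * x))].

Definition index (A a : L -> Prop) (n : nat) : Prop :=
  exists s : seq L, [/\ size s = n,
    (forall i, (i < n)%N -> A s`_i),
    (forall i j, (i < n)%N -> (j < n)%N -> a (s`_i - s`_j) -> i = j) &
    (forall x, A x -> exists2 i, (i < n)%N & a (x - s`_i))].

Definition norm (a : L -> Prop) : nat := epsilon (inhabits 0%N) (index Rloc a).

Definition deg_one (a : L -> Prop) : Prop :=
  exists n : nat, index Rloc a n /\ index Zeta (fun x => a x /\ Zeta x) n.

Definition imul (a b : L -> Prop) (x : L) : Prop :=
  exists xs ys : seq L, [/\ size xs = size ys,
    (forall i, (i < size xs)%N -> a xs`_i),
    (forall i, (i < size ys)%N -> b ys`_i) &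
    x = \sum_(i < size xs) xs`_i * ys`_i].

Definition ipow (a : L -> Prop) (e : nat) : L -> Prop := iter e (imul a) Rloc.

Definition iprod (r : nat) (ps : 'I_r -> L -> Prop) (es : 'I_r -> nat) : L -> Prop :=
  foldr (fun i acc => imul (ipow (ps i) (es i)) acc) Rloc (enum 'I_r).

Definition iset_eq (a b : L -> Prop) : Prop := forall x, a x <-> b x.

Definition prime_ideal (p : L -> Prop) : Prop :=
  [/\ is_ideal p, exists2 x, p x & x != 0, ~ p 1 &
      forall x y, Rloc x -> Rloc y -> p (x * y) -> p x \/ p y].

Definition idvd (b c : L -> Prop) : Prop :=
  exists d, is_ideal d /\ iset_eq c (imul b d).

Definition principal (x : L) (y : L) : Prop := exists2 r, Rloc r & y = x * r.

Definition gen2 (x y : L) (z : L) : Prop :=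
  exists r s, [/\ Rloc r, Rloc s & z = r * x + s * y].

Definition ramified (p : L -> Prop) : Prop :=
  exists q : nat, [/\ prime q,
    (forall x, (p x /\ Zeta x) <-> exists2 z, Zeta z & x = q%:R * z) &
    idvd (ipow p 2) (principal q%:R)].

Definition resid (a : L -> Prop) (x : L) : nat :=
  epsilon (inhabits 0%N) (fun k : nat => (k < norm a)%N /\ a (x - k%:R)).

End NFDefs.

Definition disc (f : {poly int}) : int :=
  (-1) ^+ (((size f).-1 * (size f).-2)./2) * (resultant f f^`() %/ lead_coef f)%Z.

(* Main.v *)
Require Import Defs.
From HB Require Import structures.
From mathcomp Require Import all_boot all_order all_algebra all_field.
From mathcomp Require Import ring zify.
From Stdlib Require Import ClassicalEpsilon.
Set Implicit Arguments. Unset Strict Implicit. Unset Printing Implicit Defensive.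
Import Order.TTheory GRing.Theory Num.Theory.
Local Open Scope ring_scope.

(**
An ideal a has degree one with norm n exactly when Z -> R/a is onto with
kernel nZ.

Factorization. Let p be a degree one prime above q. More than dim L elements
of R satisfy an integral relation that is nontrivial mod q; this gives at once
that p is finitely generated mod qR, that qR : p is strictly larger than qR,
and that u belongs to R as soon as all q u^k do. Together they show that p is
principal after localization at p: there are x, z in p and y in R with
y p contained in qR and q (1 - z) = x y. If y is in p, then p^2 divides qR and
p is ramified; otherwise q generates p locally, and R/p^e = Z/q^e for all e.
Distinct residue characteristics are glued by the Chinese remainder theorem.
Conversely, if Z -> R/a is onto, a prime containing a is determined by its
residue characteristic, and a contained in p^2 with p ramified would force
p = p^2.

Roots mod n. By Lagrange interpolation over the roots of f,
eta^K f'(alpha) b lies in Z[alpha] for every b in R and some K, and the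
resultant of f and f' is a multiple of f'(alpha) in Z[alpha]. So modulo n, which
is prime to eta and to the discriminant, R can be replaced by
Z[alpha], where v |-> (alpha - v, n) is evidently inverse to a |-> alpha(a).
*)

(** * The ring R and its ideals *)

Section LocalizedRing.
Variables (L : fieldExtType rat) (eta : nat).

Lemma OLE (x : L) : OL x <-> integralOver (fun z : int => z%:~R : L) x.
Proof.
split=> [[p [mp px]]|[p mp px]]; exists p => //; first by apply/rootP.
by split=> //; apply/rootP.
Qed.

Lemma OL_int (m : int) : OL (m%:~R : L).
Proof. by apply/OLE; apply: integral_id. Qed.

Lemma OLB (x y : L) : OL x -> OL y -> OL (x - y).
Proof. by move=> /OLE ? /OLE ?; apply/OLE; apply: integral_sub. Qed.

Lemma OLM (x y : L) : OL x -> OL y -> OL (x * y).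
Proof. by move=> /OLE ? /OLE ?; apply/OLE; apply: integral_mul. Qed.

Lemma OL_nat (m : nat) : OL (m%:R : L).
Proof. by rewrite pmulrn; apply: OL_int. Qed.

Lemma OL_natX (m k : nat) : OL ((m%:R : L) ^+ k).
Proof. by rewrite -natrX; apply: OL_nat. Qed.

(** A boolean form of [Rloc], decided by excluded middle, so that R can carry a subring
    structure. *)
Definition ringR : {pred L} :=
  fun x => if excluded_middle_informative (Rloc eta x) then true else false.

Lemma ringRP x : reflect (Rloc eta x) (x \in ringR).
Proof.
rewrite unfold_in /ringR; case: excluded_middle_informative => h; first by left.
by right.
Qed.

Lemma Rloc_scale_le (x : L) (k j : nat) : (k <= j)%N ->
  OL ((eta%:R : L) ^+ k * x) -> OL ((eta%:R : L) ^+ j * x).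
Proof.
move=> lekj kx; rewrite -(subnK lekj) exprD -mulrA.
by apply: OLM => //; apply: OL_natX.
Qed.

Lemma ringR_subring : subring_closed ringR.
Proof.
split=> [|x y /ringRP[k kx] /ringRP[j jy]|x y /ringRP[k kx] /ringRP[j jy]];
  apply/ringRP.
- by exists 0%N; rewrite mul1r; apply: (OL_nat 1).
- exists (maxn k j); rewrite mulrBr; apply: OLB.
    exact: Rloc_scale_le (leq_maxl _ _) kx.
  exact: Rloc_scale_le (leq_maxr _ _) jy.
- by exists (k + j)%N; rewrite exprD mulrACA; apply: OLM.
Qed.

HB.instance Definition _ := GRing.isSubringClosed.Build L ringR ringR_subring.

End LocalizedRing.

(** * Arithmetic of ideals, residue classes and the integer form of degree one *)

Section Ideals.
Variables (L : fieldExtType rat) (eta : nat).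
Hypothesis eta_gt0 : (0 < eta)%N.
Local Notation R := (@ringR L eta).
Local Notation ideal := (@is_ideal L eta).
Implicit Types (a b c p : L -> Prop) (x y z : L).

Lemma natL_neq0 n : (0 < n)%N -> (n%:R : L) != 0.
Proof.
move=> n_gt0; have := fmorph_eq0 (in_alg L) n%:R.
by rewrite rmorph_nat => ->; rewrite pnatr_eq0 -lt0n.
Qed.

Lemma etaX_neq0 k : (eta%:R : L) ^+ k != 0.
Proof. by rewrite expf_neq0 // natL_neq0. Qed.

Lemma ringR_eta x k : (eta%:R : L) ^+ k * x \in R -> x \in R.
Proof.
move=> /ringRP[j jx]; apply/ringRP; exists (j + k)%N.
by rewrite exprD -mulrA.
Qed.

Lemma Zeta_sub x : Zeta eta x -> x \in R.
Proof.
case=> z [k ->]; apply: (@ringR_eta _ k); rewrite mulrC divfK ?etaX_neq0 //.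
exact: rpred_int.
Qed.

Lemma Zeta_int (m : int) : Zeta eta (m%:~R : L).
Proof. by exists m, 0%N; rewrite expr0 divr1. Qed.

Lemma ZetaB x y : Zeta eta x -> Zeta eta y -> Zeta eta (x - y).
Proof.
case=> z [k ->] [w [j ->]].
exists (z * (eta%:Z ^+ j) - w * (eta%:Z ^+ k)), (k + j)%N.
rewrite rmorphB !rmorphM !rmorphXn /= exprD -pmulrn.
have := etaX_neq0 k; have := etaX_neq0 j.
move: (eta%:R ^+ k) (eta%:R ^+ j) => u v v0 u0.
by field; rewrite u0 v0.
Qed.

Lemma is_ideal_ring a x : ideal a -> a x -> x \in R.
Proof. by case=> h _ _ _ ax; apply/ringRP/h. Qed.
Lemma is_ideal0 a : ideal a -> a 0. Proof. by case. Qed.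
Lemma is_idealB a x y : ideal a -> a x -> a y -> a (x - y).
Proof. by case=> _ _ h _; apply: h. Qed.
Lemma is_idealMl a x y : ideal a -> x \in R -> a y -> a (x * y).
Proof. by case=> _ _ _ h /ringRP; apply: h. Qed.
Lemma is_idealMr a x y : ideal a -> x \in R -> a y -> a (y * x).
Proof. by rewrite mulrC; apply: is_idealMl. Qed.
Lemma is_idealN a x : ideal a -> a x -> a (- x).
Proof. by move=> ia ax; rewrite -sub0r; apply: is_idealB => //; apply: is_ideal0. Qed.
Lemma is_idealD a x y : ideal a -> a x -> a y -> a (x + y).
Proof.
by move=> ia ax ay; rewrite -[y]opprK; apply: is_idealB => //; apply: is_idealN.
Qed.
Lemma is_ideal_sum a (I : Type) (s : seq I) (P : pred I) (F : I -> L) : ideal a ->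
  (forall i, P i -> a (F i)) -> a (\sum_(i <- s | P i) F i).
Proof.
move=> ia aF; elim/big_ind: _ => //; first exact: is_ideal0.
by move=> x y; apply: is_idealD.
Qed.
Lemma is_ideal_modl a x y : ideal a -> a (x - y) -> a x -> a y.
Proof. by move=> ia axy ax; rewrite -[y](subKr x); apply: is_idealB. Qed.
Lemma is_ideal_modr a x y : ideal a -> a (x - y) -> a y -> a x.
Proof. by move=> ia axy ay; rewrite -[x](subrK y); apply: is_idealD. Qed.

Lemma Rloc_ideal : ideal (Rloc eta).
Proof.
split=> //; first by apply/ringRP; apply: rpred0.
  by move=> x y /ringRP ? /ringRP ?; apply/ringRP; apply: rpredB.
by move=> x y /ringRP ? /ringRP ?; apply/ringRP; apply: rpredM.
Qed.

Lemma imul_mem a b x y : a x -> b y -> imul a b (x * y).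
Proof.
move=> ax by_; exists [:: x], [:: y]; split=> //=; try by case.
by rewrite big_ord_recl big_ord0 addr0.
Qed.

(** The product is the least ideal containing the pairwise products. Later [c] is often an ideal cut
    out by a divisibility condition, which is then checked on products only. *)
Lemma imul_min a b c z : ideal c ->
  (forall x y, a x -> b y -> c (x * y)) -> imul a b z -> c z.
Proof.
move=> ic abc [xs [ys [eq_sz axs bys ->]]]; apply: is_ideal_sum => // i _.
by apply: abc; [apply: axs | apply: bys; rewrite -eq_sz].
Qed.

Lemma imulD a b x y : imul a b x -> imul a b y -> imul a b (x + y).
Proof.
case=> xs [ys [eq_sz axs bys ->]] [us [vs [eq_sz' aus bvs ->]]].
exists (xs ++ us), (ys ++ vs); split; rewrite ?size_cat ?eq_sz ?eq_sz' //.
- move=> i ltiuv; rewrite nth_cat; case: ltnP => lti; first exact: axs.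
  by apply: aus; rewrite ltn_subLR // eq_sz eq_sz'.
- move=> i ltiuv; rewrite nth_cat; case: ltnP => lti; first exact: bys.
  by apply: bvs; rewrite ltn_subLR.
- rewrite -eq_sz -eq_sz' big_split_ord /=; congr (_ + _); apply: eq_bigr => i _.
    by rewrite !nth_cat -eq_sz ltn_ord.
  by rewrite !nth_cat -eq_sz ltnNge leq_addr /= addKn.
Qed.

Lemma imul_ideal a b : ideal a -> ideal b -> ideal (imul a b).
Proof.
move=> ia ib.
have Ml r x : Rloc eta r -> imul a b x -> imul a b (r * x).
  move=> /ringRP Rr [xs [ys [eq_sz axs bys ->]]].
  exists [seq r * x | x <- xs], ys; rewrite size_map; split=> //.
    by move=> i lti; rewrite (nth_map 0) //; apply: is_idealMl => //; apply: axs.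
  rewrite mulr_sumr; apply: eq_bigr => i _.
  by rewrite (nth_map 0) // mulrA.
split=> //.
- move=> x; apply: imul_min; first exact: Rloc_ideal.
  move=> u v /(is_ideal_ring ia) Ru /(is_ideal_ring ib) Rv.
  by apply/ringRP; apply: rpredM.
- by rewrite -(mulr0 0); apply: imul_mem; apply: is_ideal0.
- move=> x y abx aby; apply: imulD => //; rewrite -mulN1r; apply: Ml => //.
  by apply/ringRP; rewrite rpredN rpred1.
Qed.

Lemma imul_subl a b x : ideal a -> ideal b -> imul a b x -> a x.
Proof.
move=> ia ib; apply: imul_min => // u v au /(is_ideal_ring ib) Rv.
exact: is_idealMr.
Qed.

Lemma imul_subr a b x : ideal a -> ideal b -> imul a b x -> b x.
Proof.
move=> ia ib; apply: imul_min => // u v /(is_ideal_ring ia) Ru bv.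
exact: is_idealMl.
Qed.

Lemma ipow_ideal a e : ideal a -> ideal (ipow eta a e).
Proof.
by move=> ia; elim: e => [|e IHe]; [apply: Rloc_ideal | apply: imul_ideal].
Qed.

Lemma ipow_le a e k x : ideal a -> (k <= e)%N ->
  ipow eta a e x -> ipow eta a k x.
Proof.
move=> ia /subnK <-; elim: (e - k)%N x => [|m IHm] x //.
by rewrite addSn => /(imul_subr ia (ipow_ideal (m + k) ia)) /IHm.
Qed.

Lemma ipow1_mem a x : ideal a -> a x -> ipow eta a 1 x.
Proof.
move=> ia ax; rewrite -[x]mulr1; apply: imul_mem => //.
by apply/ringRP; apply: rpred1.
Qed.

Lemma ipow1_sub a x : ideal a -> ipow eta a 1 x -> a x.
Proof. by move=> ia; apply: imul_subl => //; apply: Rloc_ideal. Qed.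

Lemma ipow2_mem a x y : ideal a -> a x -> a y -> ipow eta a 2 (x * y).
Proof. by move=> ia ax ay; apply: imul_mem => //; apply: ipow1_mem. Qed.

Lemma ipow_exp a x e : a x -> ipow eta a e (x ^+ e).
Proof.
move=> ax; elim: e => [|e IHe]; first by apply/ringRP; apply: rpred1.
by rewrite exprS; apply: imul_mem.
Qed.

Lemma gen2_ideal x y : x \in R -> y \in R -> ideal (gen2 eta x y).
Proof.
move=> Rx Ry; split.
- move=> z [r [s [/ringRP Rr /ringRP Rs ->]]]; apply/ringRP.
  by rewrite rpredD ?rpredM.
- exists 0, 0; split; try by apply/ringRP; apply: rpred0.
  by rewrite !mul0r addr0.
- move=> u v [r [s [/ringRP Rr /ringRP Rs ->]]] [r' [s' [/ringRP Rr' /ringRP Rs' ->]]].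
  exists (r - r'), (s - s'); split; try by apply/ringRP; apply: rpredB.
  ring.
- move=> t z /ringRP Rt [r [s [/ringRP Rr /ringRP Rs ->]]].
  exists (t * r), (t * s); split; try by apply/ringRP; apply: rpredM.
  ring.
Qed.

(* [deg1 a n]: the map from Z to R/a is onto with kernel nZ. *)
Definition deg1 a (n : nat) : Prop :=
  [/\ (0 < n)%N, a n%:R, (forall m : int, a m%:~R -> (n%:Z %| m)%Z) &
      (forall x, x \in R -> exists m : int, a (x - m%:~R))].

Lemma deg1_dvd a n (m : int) : ideal a -> deg1 a n -> (n%:Z %| m)%Z -> a m%:~R.
Proof.
move=> ia [_ an _ _] /dvdzP[k ->]; rewrite rmorphM /=.
by apply: is_idealMl => //; apply: rpred_int.
Qed.

Lemma deg1_nat a n x : ideal a -> deg1 a n -> x \in R ->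
  exists2 k : nat, (k < n)%N & a (x - k%:R).
Proof.
move=> ia da Rx; have [n_gt0 an _ sur] := da; have [m am] := sur _ Rx.
have n0 : n%:Z != 0 by rewrite -lt0n.
have := modz_ge0 m n0; have := ltz_pmod m (n_gt0 : 0 < n%:Z).
case Ek: (m %% n)%Z => [k|//] ltkn _; exists k => //.
have -> : x - k%:R = (x - m%:~R) + (m - k%:Z)%:~R.
  by rewrite rmorphB /= addrA subrK.
apply: is_idealD => //; apply: (deg1_dvd ia da).
by rewrite -Ek {1}(divz_eq m n) addrK dvdz_mull.
Qed.

(** Pigeonhole: sending [t i] to the representative of its class is an injection from m to n
    indices. When m = n it is onto, so the [t i] meet every class. *)
Lemma index_packing (A a : L -> Prop) n m (t : nat -> L) :
  (forall x y, a x -> a y -> a (x - y)) ->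
  Defs.index A a n -> (forall i, (i < m)%N -> A (t i)) ->
  (forall i j, (i < m)%N -> (j < m)%N -> a (t i - t j) -> i = j) ->
  (m <= n)%N /\ (m = n -> forall x, A x -> exists2 i, (i < m)%N & a (x - t i)).
Proof.
move=> aB [s [sz_s As inj_s sur_s]] At inj_t.
have [g gP] : exists g : 'I_m -> 'I_n, forall i : 'I_m, a (t i - s`_(g i)).
  apply: (@choice _ _ (fun (i : 'I_m) (j : 'I_n) => a (t i - s`_j))) => i.
  by have [j ltj aj] := sur_s _ (At i (ltn_ord i)); exists (Ordinal ltj).
have inj_g : injective g.
  move=> i j eq_g; apply/val_inj/(inj_t i j (ltn_ord i) (ltn_ord j)).
  by have := aB _ _ (gP i) (gP j); rewrite eq_g opprB addrA subrK.
split=> [|eq_mn x Ax].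
  by have := leq_card g inj_g; rewrite !card_ord.
have [j ltj aj] := sur_s _ Ax.
have /mapP[i _ Ei] : Ordinal ltj \in codom g.
  by apply: inj_card_onto => //; rewrite !card_ord eq_mn.
exists (i : nat) => //; have := aB _ _ aj (gP i).
have -> : x - s`_j - (t i - s`_(g i)) = x - t i by rewrite -Ei /=; ring.
by [].
Qed.

(** Packing in both directions. This pins down the value that [norm] picks by choice. *)
Lemma index_uniq (A a : L -> Prop) n m :
  (forall x y, a x -> a y -> a (x - y)) ->
  Defs.index A a n -> Defs.index A a m -> n = m.
Proof.
move=> aB In Im; have [s [ss As inj_s _]] := In; have [t [st At inj_t _]] := Im.
apply/eqP; rewrite eqn_leq.
by rewrite (index_packing (t := nth 0 t) aB In At inj_t).1
           (index_packing (t := nth 0 s) aB Im As inj_s).1.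
Qed.

Lemma index_nats (A a : L -> Prop) n :
  (forall k : nat, A k%:R) -> (forall m : int, a m%:~R -> (n%:Z %| m)%Z) ->
  (forall x, A x -> exists2 k : nat, (k < n)%N & a (x - k%:R)) ->
  Defs.index A a n.
Proof.
move=> An ker sur; exists [seq k%:R | k <- iota 0 n].
have E i : (i < n)%N -> [seq k%:R : L | k <- iota 0 n]`_i = i%:R.
  by move=> lti; rewrite (nth_map 0%N) ?size_iota // nth_iota.
split; first by rewrite size_map size_iota.
- by move=> i lti; rewrite E.
- move=> i j lti ltj; rewrite !E // => aij.
  have /ker : a (i%:Z - j%:Z)%:~R by rewrite rmorphB.
  have /ker : a (i%:Z - j%:Z)%:~R by rewrite rmorphB.
  rewrite -eqz_mod_dvd => /eqP; rewrite !modz_nat => -[].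
  by rewrite !modn_small.
- by move=> x /sur[k ltk ak]; exists k; rewrite ?E.
Qed.

Lemma deg1_index a n : ideal a -> deg1 a n ->
  Defs.index (Rloc eta) a n /\
  Defs.index (Zeta eta) (fun x => a x /\ Zeta eta x) n.
Proof.
move=> ia da; have [_ _ ker _] := da.
have Rn (k : nat) : Rloc eta (k%:R : L) by apply/ringRP; apply: rpred_nat.
have Zn (k : nat) : Zeta eta (k%:R : L) by rewrite pmulrn; apply: Zeta_int.
split; apply: index_nats => //.
- by move=> x /ringRP; apply: deg1_nat.
- by move=> m [/ker].
- move=> x Zx; have [k ltk ak] := deg1_nat ia da (Zeta_sub Zx).
  by exists k => //; split=> //; apply: ZetaB.
Qed.

Lemma deg1_norm a n : ideal a -> deg1 a n -> norm eta a = n.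
Proof.
move=> ia da; have [In _] := deg1_index ia da.
apply: (@index_uniq (Rloc eta) a) => //; first by move=> x y; apply: is_idealB.
exact: (epsilon_spec (inhabits 0%N) (Defs.index (Rloc eta) a) (ex_intro _ n In)).
Qed.

(** A common divisor g of n and eta is a unit of R, so n/g lies in a. Then n divides n/g, and g =
    1. *)
Lemma kernel_coprime_eta a n : ideal a -> (0 < n)%N -> a n%:R ->
  (forall m : int, a m%:~R -> (n%:Z %| m)%Z) -> coprime n eta.
Proof.
move=> ia n_gt0 an ker; rewrite /coprime.
set g := gcdn n eta; have g_gt0 : (0 < g)%N by rewrite gcdn_gt0 n_gt0.
have g0 := natL_neq0 g_gt0.
have [n1 En] : exists n1, n = (n1 * g)%N by apply/dvdnP; apply: dvdn_gcdl.
have [e1 Ee] : exists e1, eta = (e1 * g)%N by apply/dvdnP; apply: dvdn_gcdr.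
have Rg : (g%:R : L)^-1 \in R.
  apply: (@ringR_eta _ 1); rewrite expr1 {1}Ee natrM mulfK //; exact: rpred_nat.
have /ker : a n1%:~R.
  by rewrite -pmulrn -[n1%:R](mulfK g0) -natrM -En; apply: is_idealMr.
rewrite dvdzE /= {1}En -{2}[n1]muln1 dvdn_pmul2l ?dvdn1 //.
by move: n_gt0; rewrite {1}En muln_gt0 => /andP[].
Qed.

Lemma bezout_int (u v : int) : coprimez u v ->
  exists s t : int, s * u + t * v = 1.
Proof. by move=> /eqP c; have [s [t h]] := Bezoutz u v; exists s, t; rewrite h. Qed.

(** Let d be the least positive integer in a. It is prime to eta, so Z already fills the quotient of
    Z[1/eta], which therefore has d elements; hence d = n. The classes of 0, ..., n-1 are then n
    distinct classes among the n classes of R/a, so they exhaust it. *)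
Lemma deg_one_deg1 a n : ideal a -> Defs.index (Rloc eta) a n ->
  Defs.index (Zeta eta) (fun x => a x /\ Zeta eta x) n -> deg1 a n.
Proof.
move=> ia In Iz.
have aB x y : a x -> a y -> a (x - y) by apply: is_idealB.
have Rn (k : nat) : Rloc eta (k%:R : L) by apply/ringRP; apply: rpred_nat.
have Zn (k : nat) : Zeta eta (k%:R : L) by rewrite pmulrn; apply: Zeta_int.
pose A k : bool := if excluded_middle_informative (a (k%:R : L)) then true else false.
have AP k : reflect (a k%:R) (A k).
  by rewrite /A; case: excluded_middle_informative => h; [left | right].
(* Otherwise 0, ..., n would be n+1 distinct classes modulo a. *)
have exA : exists k, (0 < k)%N && A k.
  apply: NNPP => noA.
  have [] := @index_packing _ _ n n.+1 (fun i => i%:R) aB In; rewrite ?ltnn //.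
  move=> i j _ _ aij; apply: NNPP => neq_ij; apply: noA.
  case: (ltngtP i j) => [ltij|ltji|//].
    exists (j - i)%N; rewrite subn_gt0 ltij; apply/AP.
    by rewrite natrB 1?ltnW // -opprB; apply: is_idealN.
  by exists (i - j)%N; rewrite subn_gt0 ltji; apply/AP; rewrite natrB 1?ltnW.
case: (ex_minnP exA) => d /andP[d_gt0 /AP ad] min_d.
have ker (m : int) : a m%:~R -> (d%:Z %| m)%Z.
  have d0 : d%:Z != 0 by rewrite -lt0n.
  move=> am; have := modz_ge0 m d0; have := ltz_pmod m (d_gt0 : 0 < d%:Z).
  case Ek: (m %% d)%Z => [k|//] ltkd _.
  have ak : a k%:R.
    have -> : (k%:R : L) = m%:~R - (m %/ d)%Z%:~R * d%:R.
      rewrite [X in X%:~R - _](divz_eq m d) Ek rmorphD rmorphM /= -!pmulrn.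
      by rewrite addrC addKr.
    by apply: is_idealB => //; apply: is_idealMl => //; apply: rpred_int.
  apply/dvdz_mod0P; rewrite Ek; case: k ltkd {Ek} ak => // k ltkd ak.
  by have := min_d k.+1 (introT (AP _) ak); rewrite leqNgt => /negP[].
have n_gt0 : (0 < n)%N.
  by have [s [_ _ _ /(_ _ (Rn 0%N))[i lti _]]] := In; apply: leq_ltn_trans lti.
have cop : coprimez d%:Z eta%:Z.
  by rewrite coprimezE; apply: kernel_coprime_eta ia d_gt0 ad ker.
have surZ x : Zeta eta x -> exists m : int, a (x - m%:~R).
  case=> z [k Ex].
  have /bezout_int[s [t st]] : coprimez d%:Z (eta%:Z ^+ k).
    by rewrite coprimezE abszX coprimeXr.
  (* Modulo d, t is the inverse of eta^k, so x = z/eta^k is congruent to t z. *)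
  exists (t * z).
  have -> : x - (t * z)%:~R = (s%:~R * x) * d%:R.
    have E : s%:~R * d%:R + t%:~R * eta%:R ^+ k = 1 :> L.
      have := congr1 (fun z : int => z%:~R : L) st.
      by rewrite rmorphD !rmorphM rmorphXn /= -!pmulrn.
    have Ez : z%:~R = x * eta%:R ^+ k by rewrite Ex divfK ?etaX_neq0.
    by rewrite rmorphM /= Ez -{1}[x]mul1r -{1}E; ring.
  apply: is_idealMl => //; rewrite rpredM ?rpred_int //; apply: Zeta_sub.
  by exists z, k.
have Id : Defs.index (Zeta eta) (fun x => a x /\ Zeta eta x) d.
  apply: index_nats => //; first by move=> m [/ker].
  move=> x Zx; have [m am] := surZ x Zx.
  have d0 : d%:Z != 0 by rewrite -lt0n.
  have := modz_ge0 m d0; have := ltz_pmod m (d_gt0 : 0 < d%:Z).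
  case Ek: (m %% d)%Z => [k|//] ltkd _; exists k => //; split; last exact: ZetaB.
  have -> : x - k%:R = (x - m%:~R) + (m %/ d)%Z%:~R * d%:R.
    rewrite [X in _ - X%:~R](divz_eq m d) Ek rmorphD rmorphM /= -!pmulrn.
    ring.
  by apply: is_idealD => //; apply: is_idealMl => //; apply: rpred_int.
have Edn : d = n.
  apply: index_uniq Id Iz => x y [ax Zx] [ay Zy].
  by split; [apply: aB | apply: ZetaB].
rewrite -Edn in In *; split=> // x /ringRP Rx.
have [_ /(_ erefl _ Rx)[i _ ai]] : (d <= d)%N /\ (d = d -> forall x, Rloc eta x ->
    exists2 i, (i < d)%N & a (x - i%:R)).
  apply: (index_packing (t := fun i => i%:R) aB In) => // i j lti ltj aij.
  have /ker : a (i%:Z - j%:Z)%:~R by rewrite rmorphB.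
  rewrite -eqz_mod_dvd => /eqP; rewrite !modz_nat => -[].
  by rewrite !modn_small.
by exists i%:Z.
Qed.

Lemma deg_oneP a : ideal a -> deg_one eta a <-> exists n, deg1 a n.
Proof.
move=> ia; split=> [[n [In Iz]]|[n /(deg1_index ia) h]]; last by exists n.
by exists n; apply: deg_one_deg1.
Qed.

Lemma deg_one_norm a : ideal a -> deg_one eta a -> deg1 a (norm eta a).
Proof.
by move=> ia /(deg_oneP ia)[n da]; rewrite (deg1_norm ia da).
Qed.

End Ideals.

(** * Degree one primes *)

Section Integrality.
Variables (L : fieldExtType rat) (eta : nat).
Local Notation R := (@ringR L eta).

Lemma common_eta_power (f : nat -> L) n : (forall i, f i \in R) ->
  exists k, forall i, (i < n)%N -> OL ((eta%:R : L) ^+ k * f i).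
Proof.
move=> Rf; elim: n => [|n [k kf]]; first by exists 0%N.
have /ringRP[j jf] := Rf n; exists (maxn k j) => i.
rewrite ltnS leq_eqVlt => /predU1P[->|/kf kfi].
  exact: Rloc_scale_le (leq_maxr _ _) jf.
exact: Rloc_scale_le (leq_maxl _ _) kfi.
Qed.

(** Let e be a power of eta clearing the denominators of the coefficients of p. Then e u is a root
    of a monic polynomial with integral coefficients, hence is integral. *)
Lemma ringR_integrally_closed (p : {poly L}) u :
  p \is monic -> p \is a polyOver R -> root p u -> u \in R.
Proof.
move=> mon_p /polyOverP Rp /rootP pu0.
have [k kp] := common_eta_power (size p) Rp.
set e := (eta%:R : L) ^+ k in kp.
have OLe j : OL (e ^+ j) by rewrite /e -exprM; apply: OL_natX.
pose m := (size p).-1.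
have sz_p : size p = m.+1 by rewrite /m prednK // size_poly_gt0 monic_neq0.
have pm : p`_m = 1 by have := monicP mon_p; rewrite lead_coefE.
(* The monic polynomial e^m p(X/e). Below the top degree each coefficient has at least one factor e,
   enough to make it integral. *)
pose P := \poly_(i < m.+1) (p`_i * e ^+ (m - i)).
apply/ringRP; exists k; apply/OLE.
have P_coef i : P`_i = if (i < m.+1)%N then p`_i * e ^+ (m - i) else 0.
  by rewrite coef_poly.
apply: (@integral_root_monic _ _ _ _ P).
- apply/monicP; rewrite lead_coefE.
  have -> : (size P).-1 = m.
    by rewrite size_poly_eq //= subnn pm mul1r oner_neq0.
  by rewrite P_coef ltnSn subnn pm mulr1.
- apply/rootP; rewrite horner_poly.
  transitivity (e ^+ m * p.[u]); last by rewrite pu0 mulr0.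
  rewrite horner_coef sz_p mulr_sumr; apply: eq_bigr => i _ /=.
  have -> : e ^+ m = e ^+ (m - i) * e ^+ i by rewrite -exprD subnK // -ltnS.
  by rewrite exprMn; ring.
- apply/integral_poly => i; apply/OLE; rewrite P_coef; case: ltnP => ltim.
    move: ltim; rewrite ltnS leq_eqVlt => /predU1P[->|ltim].
      by rewrite pm mul1r subnn; apply: (OL_nat _ 1).
    have -> : (m - i)%N = (m - i).-1.+1 by rewrite prednK // subn_gt0.
    rewrite exprS mulrA [_ * e]mulrC; apply: OLM => //; apply: kp.
    by rewrite sz_p ltnW // ltnS.
  exact: (OL_nat _ 0).
Qed.

(** For [xs] in R and q prime this is linear independence over Z/q of the classes in R/qR. *)
Definition indep (q : nat) (xs : seq L) := forall c : nat -> int,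
  (\sum_(i < size xs) (c i)%:~R * xs`_i) / q%:R \in R ->
  forall i, (i < size xs)%N -> (q%:Z %| c i)%Z.

(** Descent: the coefficients of a vanishing relation are divisible by q, and dividing them by q
    gives another vanishing relation. So every power of q divides them. *)
Lemma indep_relation0 q xs (c : nat -> int) : (1 < q)%N -> indep q xs ->
  \sum_(i < size xs) (c i)%:~R * xs`_i = 0 ->
  forall i, (i < size xs)%N -> c i = 0.
Proof.
move=> q_gt1 ind c0.
have q0 : (q%:R : L) != 0 by rewrite natL_neq0 // ltnW.
have dvdX k : forall d : nat -> int, \sum_(i < size xs) (d i)%:~R * xs`_i = 0 ->
    forall i, (i < size xs)%N -> (q%:Z ^+ k %| d i)%Z.
  elim: k => [|k IHk] d d0 i lti; first by rewrite expr0 dvd1z.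
  have dE j : (j < size xs)%N -> d j = (d j %/ q)%Z * q%:Z.
    move=> ltj; rewrite divzK //; apply: ind ltj.
    by rewrite d0 mul0r rpred0.
  rewrite (dE i lti) exprSr dvdz_mul // (IHk (fun j => (d j %/ q)%Z)) //.
  apply: (mulIf q0); rewrite mul0r -[RHS]d0 mulr_suml; apply: eq_bigr => j _.
  by rewrite [in RHS]dE // rmorphM /= mulrAC.
move=> i lti; apply/eqP; rewrite -absz_eq0; apply/negPn/negP => ci0.
have := dvdX `|c i|%N c c0 i lti; rewrite dvdzE abszX /= => /dvdn_leq.
by rewrite lt0n => /(_ ci0); rewrite leqNgt ltn_expl.
Qed.

(** Independence modulo q implies independence over the rationals, after clearing denominators. This
    bounds R/qR without an integral basis. *)
Lemma indep_size q xs : (1 < q)%N -> indep q xs -> (size xs <= \dim {: L})%N.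
Proof.
move=> q_gt1 ind.
suff /eqP <- : free xs by rewrite dimvS // subvf.
rewrite -[xs]/(tval (in_tuple xs)); apply/freeP => k k0 i.
pose K j := if insub j is Some j' then k j' else 0.
have KE (j : 'I_(size xs)) : K j = k j by rewrite /K valK.
(* Packing the coefficients into a polynomial provides a common denominator. *)
pose P := \poly_(j < size xs) K j.
have [p [a a0 Pp]] := rat_poly_scale P.
have kE (j : 'I_(size xs)) : k j = a%:~R^-1 * (p`_j)%:~R.
  have := congr1 (fun r : {poly rat} => r`_j) Pp.
  by rewrite /P coef_poly ltn_ord KE coefZ coef_map.
have {}a0 : (a%:~R : rat) != 0 by rewrite intr_eq0.
rewrite kE; have -> : p`_i = 0; last by rewrite mulr0.
apply: (indep_relation0 (c := fun j => p`_j) q_gt1 ind) => //.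
transitivity (a%:~R *: \sum_(j < size xs) k j *: (in_tuple xs)`_j); last first.
  by rewrite k0 scaler0.
rewrite scaler_sumr; apply: eq_bigr => j _; rewrite kE scalerA mulrA divff //.
by rewrite mul1r /= scaler_int mulrzl.
Qed.

Lemma dependent_family q (w : nat -> L) : (1 < q)%N ->
  exists n (c : nat -> int),
    (\sum_(i < n) (c i)%:~R * w i) / q%:R \in R /\
    exists2 i, (i < n)%N & ~~ (q%:Z %| c i)%Z.
Proof.
move=> q_gt1; pose n := (\dim {: L}).+1; apply: NNPP => noc.
have: indep q (mkseq w n).
  move=> c; rewrite size_mkseq => Rc i lti; apply/negPn/negP => qc; apply: noc.
  exists n, c; split; last by exists i.
  by under eq_bigr => j _ do rewrite -(nth_mkseq 0 w (ltn_ord j)).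
by move/(indep_size q_gt1); rewrite size_mkseq ltnn.
Qed.

(** A dependence among q u, q u^2, ... modulo q, divided by q, puts an integral combination of
    powers of u in R with some coefficient prime to q. It is turned into a monic equation for u over
    R. *)
Lemma almost_integral q u : prime q ->
  (forall k, q%:R * u ^+ k \in R) -> u \in R.
Proof.
move=> pr_q Rqu; have q_gt1 := prime_gt1 pr_q.
have q0 : (q%:R : L) != 0 by rewrite natL_neq0 // ltnW.
have [n [c [Rc cn]]] := dependent_family (fun i => q%:R * u ^+ i.+1) q_gt1.
have {}Rc : \sum_(i < n) (c i)%:~R * u ^+ i.+1 \in R.
  move: Rc; under eq_bigr => i _ do rewrite mulrCA.
  by rewrite -mulr_sumr mulrAC divff // mul1r.
(* Top terms with coefficient divisible by q lie in R and are dropped, until the leading coefficient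
   is prime to q. *)
have {n Rc cn}[n [qc Rc]] : exists n, ~~ (q%:Z %| c n)%Z /\
    \sum_(i < n.+1) (c i)%:~R * u ^+ i.+1 \in R.
  elim: n Rc cn => [|n IHn] Rc [i lti qc]; first by [].
  have [qcn|] := boolP (q%:Z %| c n)%Z; last by exists n.
  apply: IHn.
    move: Rc; rewrite big_ord_recr /= rpredDr //.
    have /dvdzP[d ->] := qcn; rewrite rmorphM /= -mulrA rpredM ?rpred_int //.
  exists i => //; move: lti; rewrite ltnS leq_eqVlt => /predU1P[Ei|//].
  by move: qc; rewrite Ei qcn.
have /bezout_int[s [t st]] : coprimez q%:Z (c n).
  by rewrite coprimezE /= prime_coprime.
have stL : s%:~R * q%:R + t%:~R * (c n)%:~R = 1 :> L.
  by have := congr1 (fun z : int => z%:~R : L) st; rewrite rmorphD !rmorphM.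
(* Since s q + t c_n = 1, [r] equals u^(n+1) plus the lower terms t c_i u^(i+1), and it lies in R:
   it is minus the constant term of the monic equation. *)
set r := s%:~R * (q%:R * u ^+ n.+1) + t%:~R * \sum_(i < n.+1) (c i)%:~R * u ^+ i.+1.
pose S := \sum_(i < n) (t * c i)%:~R *: 'X^(i.+1) - r%:P : {poly L}.
have RS : S \is a polyOver R.
  rewrite rpredB ?polyOverC //.
    apply: rpred_sum => i _; rewrite polyOverZ ?rpred_int //.
    by rewrite rpredX ?polyOverX.
  by apply: rpredD; apply: rpredM; rewrite ?rpred_int // Rqu.
have sz_S : (size S < n.+2)%N.
  rewrite ltnS (leq_trans (size_polyD _ _)) // geq_max size_polyN.
  rewrite (leq_trans (size_polyC_leq1 _)) // andbT.
  apply: (leq_trans (size_sum _ _ _)); apply/bigmax_leqP => i _.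
  by rewrite (leq_trans (size_scale_leq _ _)) // size_polyXn ltnS.
apply: (@ringR_integrally_closed ('X^(n.+1) + S)).
- by apply/monicP; rewrite lead_coefDl ?lead_coefXn // size_polyXn.
- by rewrite rpredD // rpredX ?polyOverX.
apply/rootP; rewrite !hornerE horner_sum.
under eq_bigr => i _ do rewrite hornerZ hornerXn rmorphM /= -mulrA.
rewrite -mulr_sumr /r big_ord_recr /=.
move: (\sum_(i < n) _) => T; rewrite -{1}[u ^+ _]mul1r -{1}stL; ring.
Qed.

(** If no finite family spans p modulo qR, independent families in p can be extended forever,
    against the bound by the dimension. *)
Lemma finite_span q (p : L -> Prop) : prime q -> is_ideal eta p ->
  exists2 xs : seq L, (forall i, (i < size xs)%N -> p xs`_i) &
    forall x, p x -> exists c : nat -> int,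
      (x - \sum_(i < size xs) (c i)%:~R * xs`_i) / q%:R \in R.
Proof.
move=> pr_q ip; have q_gt1 := prime_gt1 pr_q.
have q0 : (q%:R : L) != 0 by rewrite natL_neq0 // ltnW.
apply: NNPP => noxs.
have long n : exists xs : seq L, [/\ size xs = n, indep q xs &
    forall i, (i < size xs)%N -> p xs`_i].
  elim: n => [|n [xs [sz_xs ind pxs]]]; first by exists [::]; split.
  apply: NNPP => nobig; apply: noxs; exists xs => // x px.
  apply: NNPP => nospan; apply: nobig; exists (rcons xs x).
  split; first by rewrite size_rcons sz_xs.
    move=> c; rewrite size_rcons big_ord_recr /= nth_rcons ltnn eqxx.
    under eq_bigr => i _ do rewrite nth_rcons ltn_ord.
    move=> Rc; have qcn : (q%:Z %| c (size xs))%Z.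
      apply/negPn/negP => qc; apply: nospan.
      have /bezout_int[s [t st]] : coprimez q%:Z (c (size xs)).
        by rewrite coprimezE /= prime_coprime.
      have stL : s%:~R * q%:R + t%:~R * (c (size xs))%:~R = 1 :> L.
        by have := congr1 (fun z : int => z%:~R : L) st; rewrite rmorphD !rmorphM.
      (* With t inverse to the coefficient of x modulo q, the relation is solved for x. *)
      exists (fun i => - (t * c i)).
      under eq_bigr => i _ do rewrite rmorphN rmorphM /= mulNr -mulrA.
      rewrite sumrN opprK -mulr_sumr.
      move: Rc; move: (\sum_(i < _) _) => T Rc.
      have -> : (x + t%:~R * T) / q%:R =
          s%:~R * x + t%:~R * ((T + (c (size xs))%:~R * x) / q%:R).
        by rewrite -{1}[x]mul1r -{1}stL; field.
      by rewrite rpredD // rpredM ?rpred_int // (is_ideal_ring ip).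
    move=> i; rewrite ltnS leq_eqVlt => /predU1P[->//|]; apply: ind.
    move: Rc; rewrite mulrDl rpredDr //.
    have /dvdzP[d ->] := qcn; rewrite rmorphM /= mulrAC mulfK //.
    by rewrite rpredM ?rpred_int // (is_ideal_ring ip).
  move=> i; rewrite size_rcons nth_rcons ltnS leq_eqVlt => /predU1P[->|lti].
    by rewrite ltnn eqxx.
  by rewrite lti; apply: pxs.
have [xs [sz_xs /(indep_size q_gt1)]] := long (\dim {: L}).+1.
by rewrite sz_xs ltnn.
Qed.

End Integrality.

(** * Local structure of R at a degree one prime *)

Section DegreeOnePrime.
Variables (L : fieldExtType rat) (eta : nat).
Hypothesis eta_gt0 : (0 < eta)%N.
Local Notation R := (@ringR L eta).
Variables (p : L -> Prop) (q : nat).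
Hypotheses (prim_p : prime_ideal eta p) (p1q : deg1 eta p q).

Let ip : is_ideal eta p. Proof. by case: prim_p. Qed.

Lemma prime_idealP x y : x \in R -> y \in R -> p (x * y) -> p x \/ p y.
Proof. by case: prim_p => _ _ _ h /ringRP ? /ringRP; apply: h. Qed.

Lemma deg1_residue_prime : prime q.
Proof.
have [q_gt0 pq ker _] := p1q; have [_ _ p1 _] := prim_p.
have q_gt1 : (1 < q)%N.
  by case: (q) q_gt0 pq => [|[|]] // _ /p1.
apply/primeP; split=> // d /dvdnP[k Eq].
have /prime_idealP[] : p (k%:R * d%:R) by rewrite -natrM -Eq.
- exact: rpred_nat.
- exact: rpred_nat.
- rewrite pmulrn => /ker; rewrite dvdzE /= => /dvdn_leq.
  have k_gt0 : (0 < k)%N by move: q_gt0; rewrite Eq muln_gt0 => /andP[].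
  move=> /(_ k_gt0); rewrite Eq -{2}[k]muln1 leq_pmul2l // => d_le1.
  by move: q_gt0; rewrite Eq muln_gt0 k_gt0; case: d d_le1 {Eq} => [|[|]].
rewrite pmulrn => /ker; rewrite dvdzE /= => qd.
by apply/orP; right; rewrite eqn_dvd qd andbT Eq dvdn_mull.
Qed.

Let pr_q := deg1_residue_prime.
Let q_gt1 := prime_gt1 pr_q.

Lemma q_neq0 : (q%:R : L) != 0.
Proof. by rewrite natL_neq0 // ltnW. Qed.
Let q0 := q_neq0.

Let pq : p q%:R. Proof. by case: p1q. Qed.
Let Rq : (q%:R : L) \in R. Proof. exact: rpred_nat. Qed.

Lemma prime_ideal_int (m : int) : p m%:~R <-> (q%:Z %| m)%Z.
Proof.
split; first by case: p1q => _ _ ker _; apply: ker.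
exact: deg1_dvd ip p1q.
Qed.

(* R/p is the prime field, so inverses mod p are integers. *)
Lemma prime_ideal_inv x : x \in R -> ~ p x ->
  exists b : int, p (1 - b%:~R * x).
Proof.
move=> Rx npx; have [_ _ _ sur] := p1q; have [m pm] := sur _ Rx.
have qm : ~~ (q%:Z %| m)%Z.
  by apply/negP => /prime_ideal_int /(is_ideal_modr ip pm).
have /bezout_int[s [t st]] : coprimez q%:Z m.
  by rewrite coprimezE /= prime_coprime.
exists t; have -> : 1 - t%:~R * x = s%:~R * q%:R - t%:~R * (x - m%:~R).
  have stL : s%:~R * q%:R + t%:~R * m%:~R = 1 :> L.
    by have := congr1 (fun z : int => z%:~R : L) st; rewrite rmorphD !rmorphM.
  by rewrite -{1}stL; ring.
by apply: (is_idealB ip) => //; apply: (is_idealMl ip) => //; apply: rpred_int.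
Qed.

(** A relation among the powers of x modulo q, cut at its first coefficient c prime to q, reads x^j
    (c + x T) in qR. Here c + x T is outside p because c is. *)
Lemma local_nilpotent x : p x ->
  exists s k, [/\ s \in R, ~ p s & s * x ^+ k / q%:R \in R].
Proof.
move=> px; have Rx := is_ideal_ring ip px.
have [n [c [Rc cn]]] := dependent_family eta (fun i => x ^+ i) q_gt1.
have {Rc} : x ^+ 0 * (\sum_(i < n) (c i)%:~R * x ^+ i) / q%:R \in R.
  by rewrite expr0 mul1r.
(* The exponent j counts the low terms already discarded. *)
elim: n c cn 0%N => [|n IHn] c [i lti qci] j; first by [].
rewrite big_ord_recl expr0 mulr1.
under eq_bigr => k _ do rewrite /= /bump add1n exprS mulrCA.
rewrite -mulr_sumr; set T := \sum_(k < n) _ => Rc.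
have RT : T \in R.
  by apply: rpred_sum => k _; rewrite rpredM ?rpred_int ?rpredX.
have [qc0|qc0] := boolP (q%:Z %| c 0%N)%Z; last first.
  exists ((c 0%N)%:~R + x * T), j; split; last by rewrite [_ * x ^+ j]mulrC.
    by rewrite rpredD ?rpred_int ?rpredM.
  move=> ps; move/negP: qc0; apply; apply/prime_ideal_int.
  rewrite -[_%:~R](addrK (x * T)); apply: (is_idealB ip) => //.
  exact: (is_idealMr ip RT px).
apply: (IHn (fun k => c k.+1) _ j.+1).
  by case: i lti qci => [|i] lti qci; [rewrite qc0 in qci | exists i].
move: Rc; rewrite mulrDr mulrDl rpredDl; first by rewrite mulrA -exprSr.
have /dvdzP[d ->] := qc0; rewrite rmorphM /= mulrA mulfK //.
by rewrite rpredM ?rpred_int ?rpredX.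
Qed.

(* p/qR is an associated prime of R/qR. *)
Lemma annihilator : exists t,
  [/\ t \in R, t / q%:R \notin R & forall x, p x -> t * x / q%:R \in R].
Proof.
have [xs pxs span] := finite_span pr_q ip.
suff [t [Rt nt txs]] : exists t, [/\ t \in R, t / q%:R \notin R &
    forall i, (i < size xs)%N -> t * xs`_i / q%:R \in R].
  exists t; split=> // x /span[c Rc].
  rewrite -[x](subrK (\sum_(i < size xs) (c i)%:~R * xs`_i)) mulrDr mulrDl.
  apply: rpredD; first by rewrite -mulrA rpredM.
  rewrite mulr_sumr mulr_suml; apply: rpred_sum => i _; rewrite mulrCA -mulrA rpredM ?rpred_int //.
  exact: txs.
(* The multiplier s outside p is carried along so that the induction on the generators can absorb
   the factor supplied by [local_nilpotent]. *)
suff: forall s, s \in R -> ~ p s -> exists r, [/\ r \in R, s * r / q%:R \notin R &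
    forall i, (i < size xs)%N -> s * r * xs`_i / q%:R \in R].
  have [_ _ p1 _] := prim_p.
  move=> /(_ 1 (rpred1 _) p1)[r [Rr nr rxs]]; exists r.
  by rewrite mul1r in nr rxs; split.
have ndvd s : s \in R -> ~ p s -> s / q%:R \notin R.
  move=> Rs nps; apply/negP => Rsq; apply: nps.
  by rewrite -[s](divfK q0); apply: (is_idealMl ip).
elim: xs pxs {span} => [|x xs IHxs] pxs s Rs nps.
  by exists 1; rewrite rpred1 mulr1 ndvd.
have px : p x := pxs 0%N isT; have Rx := is_ideal_ring ip px.
have [sx [k [Rsx npsx sxk]]] := local_nilpotent px.
have npss : ~ p (s * sx) by case/prime_idealP.
have [|r [Rr nr rxs]] := IHxs _ (s * sx) (rpredM Rs Rsx) npss.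
  by move=> i lti; apply: (pxs i.+1).
set v := s * sx * r in nr rxs.
(* The place where v x^j enters qR: it starts outside at j = 0 and is inside at j = k. *)
have [j [nj jx]] : exists j, v * x ^+ j / q%:R \notin R /\
    v * x ^+ j * x / q%:R \in R.
  have : v * x ^+ k / q%:R \in R.
    have -> : v * x ^+ k / q%:R = s * r * (sx * x ^+ k / q%:R).
      by rewrite /v; ring.
    by apply: rpredM => //; apply: rpredM.
  elim: k {sxk} => [|k IHk]; first by rewrite expr0 mulr1 (negbTE nr).
  move=> Rk; have [/IHk //|nk] := boolP (v * x ^+ k / q%:R \in R).
  by exists k; split=> //; rewrite -[v * _ * x]mulrA -exprSr.
exists (sx * r * x ^+ j).
have Ev : s * (sx * r * x ^+ j) = v * x ^+ j by rewrite /v; ring.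
rewrite Ev; split=> // [|[|i] lti]; first by rewrite !rpredM ?rpredX.
  exact: jx.
have -> : v * x ^+ j * (x :: xs)`_i.+1 / q%:R =
    x ^+ j * (v * xs`_i / q%:R) by rewrite /=; ring.
by rewrite rpredM ?rpredX ?rxs.
Qed.

(* p becomes principal after localization at p. *)
Lemma locally_principal : exists x y z, [/\ p x, p z, y \in R,
  (forall w, p w -> y * w / q%:R \in R) & q%:R * (1 - z) = x * y].
Proof.
have [t [Rt nt tp]] := annihilator.
(* If t/q mapped p into p, then q (t/q)^k would lie in R for all k, and t/q would be in R by
   [almost_integral]. *)
have [x [px npx]] : exists x, p x /\ ~ p (t * x / q%:R).
  apply: NNPP => allp; move/negP: nt; apply.
  apply: (almost_integral pr_q) => k; apply: (is_ideal_ring ip).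
  elim: k => [|k IHk]; first by rewrite mulr1.
  have -> : q%:R * (t / q%:R) ^+ k.+1 = t * (q%:R * (t / q%:R) ^+ k) / q%:R.
    by rewrite exprS; ring.
  by apply: NNPP => np; apply: allp; exists (q%:R * (t / q%:R) ^+ k).
have [b pb] := prime_ideal_inv (tp _ px) npx.
(* Here b inverts t x/q modulo p, which makes the third witness an element of p. *)
exists (b%:~R * x), t, (1 - b%:~R * (t * x / q%:R)); split=> //.
  by apply: (is_idealMl ip) => //; apply: rpred_int.
by field.
Qed.

(** Multiplication by y/q sends p into R, hence p^2 into p. If p = p^2, then x y/q = 1 - z would lie
    in p, and so would 1. *)
Lemma not_idempotent : ~ (forall x, p x -> ipow eta p 2 x).
Proof.
move=> idem; have [x [y [z [px pz Ry yp E]]]] := locally_principal.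
have [_ _ p1 _] := prim_p; apply: p1.
rewrite -[1](subrK z); apply: (is_idealD ip) => //.
have -> : 1 - z = y * x / q%:R by rewrite [y * x]mulrC -E mulrAC divff // mul1r.
have ic : is_ideal eta (fun w => w \in R /\ p (y * w / q%:R)).
  split.
  - by move=> w [/ringRP].
  - by rewrite rpred0 mulr0 mul0r; split=> //; apply: (is_ideal0 ip).
  - move=> u v [Ru pu] [Rv pv]; rewrite rpredB // mulrBr mulrBl; split=> //.
    exact: (is_idealB ip).
  - move=> u v /ringRP Ru [Rv pv]; rewrite rpredM //; split=> //.
    have -> : y * (u * v) / q%:R = u * (y * v / q%:R) by ring.
    exact: (is_idealMl ip).
suff: x \in R /\ p (y * x / q%:R) by case.
have := idem _ px; apply: (imul_min ic) => u v pu /(ipow1_sub ip) pv.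
split; first by rewrite rpredM // (is_ideal_ring ip).
have -> : y * (u * v) / q%:R = (y * u / q%:R) * v by ring.
by apply: (is_idealMl ip) => //; apply: yp.
Qed.

(** The cofactor of p^2 is the quotient ideal (qR : p^2). As y is in p, it contains y^2/q besides q,
    and this suffices to write q as an element of the product. *)
Lemma ramifiedI x y z : p x -> p y -> p z ->
  (forall w, p w -> y * w / q%:R \in R) -> q%:R * (1 - z) = x * y ->
  ramified eta p.
Proof.
move=> px py pz yp E; have Rz := is_ideal_ring ip pz.
exists q; split=> //.
- move=> w; split=> [[pw [m [k Ew]]]|[u Zu ->]]; last first.
    split; last by case: Zu => m [k ->]; exists (q%:Z * m), k; rewrite rmorphM mulrA.
    by apply: (is_idealMr ip) => //; apply: Zeta_sub.
  have /prime_ideal_int/dvdzP[m' Em] : p m%:~R.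
    have -> : m%:~R = (eta%:R : L) ^+ k * w.
      by rewrite Ew mulrCA divff ?mulr1 // etaX_neq0.
    by apply: (is_idealMl ip) => //; rewrite rpredX ?rpred_nat.
  exists (m'%:~R / eta%:R ^+ k); first by exists m', k.
  by rewrite Ew Em rmorphM /= mulrCA mulrA.
pose d w := w \in R /\ forall u, ipow eta p 2 u -> w * u / q%:R \in R.
have id : is_ideal eta d.
  split.
  - by move=> w [/ringRP].
  - by split=> [|u _]; rewrite ?mul0r rpred0.
  - move=> u v [Ru du] [Rv dv]; split=> [|w pw]; first exact: rpredB.
    by rewrite mulrBl mulrBl rpredB ?du ?dv.
  - move=> u v /ringRP Ru [Rv dv]; split=> [|w pw]; first exact: rpredM.
    by rewrite -!mulrA rpredM // mulrA dv.
have ip2 := ipow_ideal 2 ip.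
exists d; split=> // w; split=> [[r /ringRP Rr ->]|]; last first.
  suff ic : is_ideal eta (principal eta (q%:R : L)).
    apply: (imul_min ic) => u v pu [_ dv].
    exists (v * u / q%:R); first by apply/ringRP; apply: dv.
    by field.
  split.
  - by move=> u [r /ringRP Rr ->]; apply/ringRP; rewrite rpredM.
  - by exists 0; [apply/ringRP; apply: rpred0 | rewrite mulr0].
  - move=> u v [r /ringRP Rr ->] [s /ringRP Rs ->].
    by exists (r - s); [apply/ringRP; apply: rpredB | rewrite mulrBr].
  - move=> u v /ringRP Ru [r /ringRP Rr ->].
    by exists (u * r); [apply/ringRP; apply: rpredM | rewrite mulrCA].
apply: (is_idealMr (imul_ideal ip2 id)) => //.
(* (1 - z)^2 and z^2 are comaximal; q(1 - z)^2 = x^2 (y^2/q). *)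
have -> : q%:R = (x * x) * (y * y / q%:R * (1 + z *+ 2))
    + (z * z) * (q%:R * (3 - z *+ 2)).
  have -> : (x * x) * (y * y / q%:R * (1 + z *+ 2)) =
     (x * y) * (x * y) / q%:R * (1 + z *+ 2) by ring.
  by rewrite -E; field.
apply: imulD; apply: imul_mem; try exact: ipow2_mem.
  apply: (is_idealMr id) => //; first by rewrite rpredD ?rpred1 ?rpredMn.
  split=> [|u]; first exact: yp.
  have ic : is_ideal eta (fun u => u \in R /\ y * y / q%:R * u / q%:R \in R).
    have Ryy : y * y / q%:R \in R by apply: yp.
    split.
    - by move=> v [/ringRP].
    - by rewrite mulr0 mul0r rpred0.
    - move=> v v' [Rv dv] [Rv' dv']; rewrite rpredB //; split=> //.
      by rewrite mulrBr mulrBl rpredB.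
    - move=> v v' /ringRP Rv [Rv' dv']; rewrite rpredM //; split=> //.
      have -> : y * y / q%:R * (v * v') / q%:R = v * (y * y / q%:R * v' / q%:R).
        by ring.
      exact: rpredM.
  move=> p2u; suff: u \in R /\ y * y / q%:R * u / q%:R \in R by case.
  move: p2u; apply: (imul_min ic) => v v' pv /(ipow1_sub ip) pv'.
  split; first by rewrite rpredM ?(is_ideal_ring ip).
  (* One factor y/q is spent on each of [v] and [v']. *)
  have -> : y * y / q%:R * (v * v') / q%:R = (y * v / q%:R) * (y * v' / q%:R).
    by ring.
  by rewrite rpredM ?yp.
apply: (is_idealMr id) => //; first by rewrite rpredB ?rpred_nat ?rpredMn.
split=> // u p2u; rewrite mulrAC divff // mul1r.
exact: is_ideal_ring p2u.
Qed.

(** In the unramified case q generates p locally. Multiplying by (y/q)^s strips s factors of p,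
    which gives the kernel; expanding elements in powers of q with integer digits gives
    surjectivity. *)
Lemma deg1_ipow e : ~ ramified eta p \/ e = 1%N ->
  deg1 eta (ipow eta p e) (q ^ e).
Proof.
case=> [unram|->]; last first.
  have [h1 h2 h3 h4] := p1q; rewrite expn1; split=> //.
  - exact: ipow1_mem.
  - by move=> m /(ipow1_sub ip) /h3.
  - by move=> x /h4[m pm]; exists m; apply: ipow1_mem.
(* By [ramifiedI] the y of [locally_principal] is outside p, so it can be scaled to be 1 modulo
   p. *)
have [y [Ry py yp]] : exists y, [/\ y \in R, p (1 - y) &
    forall w, p w -> y * w / q%:R \in R].
  have [x [y [z [px pz Ry yp E]]]] := locally_principal.
  have npy : ~ p y by move=> py; apply: unram; apply: ramifiedI yp E.
  have [b pb] := prime_ideal_inv Ry npy; exists (b%:~R * y); split=> //.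
    by rewrite rpredM ?rpred_int.
  by move=> w pw; rewrite -!mulrA rpredM ?rpred_int // mulrA yp.
have npy : ~ p y.
  by move=> py'; have [_ _ p1 _] := prim_p; apply: p1; exact: (is_ideal_modr ip py py').
have pqe : ipow eta p e (q ^ e)%:R by rewrite natrX; apply: ipow_exp.
have ipe := ipow_ideal e ip.
split=> //; first by rewrite expn_gt0 ltnW.
- move=> m pm.
  suff: forall s, (s <= e)%N -> (q%:Z ^+ s %| m)%Z.
    by move/(_ e (leqnn e)); rewrite !dvdzE abszX.
  have localize s w : ipow eta p s.+1 w -> w \in R /\ p (y ^+ s * w / q%:R ^+ s).
    elim: s w => [|s IHs] w.
      move/(ipow1_sub ip) => pw; rewrite !expr0 mul1r divr1; split=> //.
      exact: is_ideal_ring pw.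
    have ic : is_ideal eta (fun w => w \in R /\ p (y ^+ s.+1 * w / q%:R ^+ s.+1)).
      split.
      - by move=> v [/ringRP].
      - by rewrite rpred0 mulr0 mul0r; split=> //; apply: (is_ideal0 ip).
      - move=> u v [Ru pu] [Rv pv]; rewrite rpredB // mulrBr mulrBl; split=> //.
        exact: (is_idealB ip).
      - move=> u v /ringRP Ru [Rv pv]; rewrite rpredM //; split=> //.
        have -> : y ^+ s.+1 * (u * v) / q%:R ^+ s.+1
          = u * (y ^+ s.+1 * v / q%:R ^+ s.+1) by ring.
        exact: (is_idealMl ip).
    apply: (imul_min ic).
    move=> u v pu /IHs[Rv pv]; split; first by rewrite rpredM // (is_ideal_ring ip).
    have -> : y ^+ s.+1 * (u * v) / q%:R ^+ s.+1 =
        (y * u / q%:R) * (y ^+ s * v / q%:R ^+ s).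
      by rewrite !exprS invfM; ring.
    by apply: (is_idealMl ip) => //; apply: yp.
  elim=> [|s IHs] lts; first by rewrite expr0 dvd1z.
  have /dvdzP[m' Em] := IHs (ltnW lts).
  have [_] := localize _ _ (ipow_le ip lts pm).
  have -> : y ^+ s * m%:~R / q%:R ^+ s = y ^+ s * m'%:~R.
    rewrite Em rmorphM rmorphXn /= -pmulrn; field.
    by rewrite expf_neq0.
  have : ~ p (y ^+ s).
    elim: (s) => [|j IHj]; first by case: prim_p.
    by rewrite exprS => /prime_idealP[]//; rewrite rpredX.
  move=> nps /prime_idealP[]; rewrite ?rpredX ?rpred_int //.
  by move/prime_ideal_int => qm'; rewrite Em exprS dvdz_mul.
(* This is p = p^k + qR, by iterating w = (1 - y) w + q (y w/q). *)
have split_p k z : p z -> exists w r, [/\ p w, ipow eta p k w, r \in R &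
    z = w + q%:R * r].
  move=> pz; elim: k => [|k [w [r [pw pkw Rr Ez]]]].
    exists z, 0; rewrite rpred0 mulr0 addr0; split=> //.
    exact/ringRP/(is_ideal_ring ip).
  exists ((1 - y) * w), (y * w / q%:R + r); split.
  - by apply: (is_idealMl ip) => //; rewrite rpredB ?rpred1.
  - exact: imul_mem.
  - by rewrite rpredD ?yp.
  - by rewrite Ez; field.
(* The first k digits of x in base q, up to an element of p^e. At k = e the remainder q^e r is also
   in p^e. *)
have approx k x : x \in R -> exists (m : int) w r, [/\ ipow eta p e w, r \in R &
    x = m%:~R + w + q%:R ^+ k * r].
  move=> Rx; elim: k => [|k [m [w [r [pw Rr Ex]]]]].
    exists 0, 0, x; split=> //; first exact: (is_ideal0 ipe).
    by rewrite mul1r !add0r.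
  have [_ _ _ /(_ r Rr)[m1 pm1]] := p1q.
  have [w1 [r1 [_ pw1 Rr1 Er]]] := split_p e _ pm1.
  exists (m + q%:Z ^+ k * m1), (w + q%:R ^+ k * w1), r1; split=> //.
    by apply: (is_idealD ipe) => //; apply: (is_idealMl ipe) => //; rewrite rpredX.
  rewrite Ex -[r](subrK m1%:~R) Er rmorphD rmorphM rmorphXn /= -pmulrn exprS.
  ring.
move=> x /(approx e)[m [w [r [pw Rr ->]]]]; exists m.
have -> : m%:~R + w + q%:R ^+ e * r - m%:~R = w + q%:R ^+ e * r by ring.
by apply: (is_idealD ipe) => //; apply: (is_idealMr ipe) => //; rewrite -natrX.
Qed.

End DegreeOnePrime.

(** * Factorization of degree one ideals *)

Section Factorization.
Variables (L : fieldExtType rat) (eta : nat).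
Hypothesis eta_gt0 : (0 < eta)%N.
Local Notation R := (@ringR L eta).

(** Chinese remainder theorem: with s n + t m = 1, the integer i t m + j s n has the residues i
    modulo a and j modulo b, and the error is visibly in the product ideal. *)
Lemma deg1_mul (a b : L -> Prop) n m : is_ideal eta a -> is_ideal eta b ->
  coprime n m -> deg1 eta a n -> deg1 eta b m ->
  deg1 eta (imul a b) (n * m).
Proof.
move=> ia ib cop da db.
have [n_gt0 an kera sura] := da; have [m_gt0 bm kerb surb] := db.
have /bezout_int[s [t st]] : coprimez n%:Z m%:Z by [].
have stL : s%:~R * n%:R + t%:~R * m%:R = 1 :> L.
  by have := congr1 (fun z : int => z%:~R : L) st; rewrite rmorphD !rmorphM.
split; first by rewrite muln_gt0 n_gt0.
- by rewrite natrM; apply: imul_mem.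
- move=> k abk; rewrite PoszM Gauss_dvdz //.
  by rewrite (kera _ (imul_subl ia ib abk)) (kerb _ (imul_subr ia ib abk)).
- move=> x Rx; have [i ai] := sura _ Rx; have [j bj] := surb _ Rx.
  exists (i * (t * m%:Z) + j * (s * n%:Z)).
  have -> : x - (i * (t * m%:Z) + j * (s * n%:Z))%:~R =
     (x - i%:~R) * (t%:~R * m%:R) + (s%:~R * n%:R) * (x - j%:~R).
    by rewrite rmorphD !rmorphM /= -!pmulrn -{1}[x]mul1r -{1}stL; ring.
  apply: imulD; apply: imul_mem => //.
    by apply: (is_idealMl ib) => //; apply: rpred_int.
  by apply: (is_idealMl ia) => //; apply: rpred_int.
Qed.

Variables (r : nat) (ps : 'I_r -> L -> Prop) (es : 'I_r -> nat).
Hypothesis prim_ps : forall i, prime_ideal eta (ps i).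

Let fprod s := foldr (fun i acc => imul (ipow eta (ps i) (es i)) acc) (Rloc eta) s.

Let ips i : is_ideal eta (ps i). Proof. by case: (prim_ps i). Qed.

Lemma foldr_imul_ideal s : is_ideal eta (fprod s).
Proof.
elim: s => [|i s IHs] /=; first exact: Rloc_ideal.
by apply: imul_ideal => //; apply: ipow_ideal.
Qed.

Lemma foldr_imul_sub s i x : i \in s -> fprod s x -> ipow eta (ps i) (es i) x.
Proof.
elim: s => [|j s IHs] //=; rewrite inE => /predU1P[->|/IHs is_].
  by apply: imul_subl; [apply: ipow_ideal | apply: foldr_imul_ideal].
move=> h; apply: is_; move: h.
by apply: imul_subr; [apply: ipow_ideal | apply: foldr_imul_ideal].
Qed.

Lemma deg1_foldr_imul (q : 'I_r -> nat) s : uniq s ->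
  (forall i, deg1 eta (ipow eta (ps i) (es i)) (q i ^ es i)) ->
  (forall i j, i != j -> coprime (q i) (q j)) ->
  deg1 eta (fprod s) (\prod_(i <- s) q i ^ es i).
Proof.
move=> + dq cop; elim: s => [|i s IHs] /=.
  rewrite big_nil => _; split=> //; first by apply/ringRP; apply: rpred1.
  by move=> x /ringRP Rx; exists 0; rewrite subr0.
case/andP=> nis /IHs ds; rewrite big_cons; apply: deg1_mul => //.
- exact: ipow_ideal.
- exact: foldr_imul_ideal.
- rewrite big_seq; elim/big_rec: _ => [|j m js IHm]; first exact: coprimen1.
  rewrite coprimeMr IHm andbT coprimeXl // coprimeXr // cop //.
  by apply: contraNneq nis => ->.
Qed.

Lemma deg1_ext (a b : L -> Prop) n :
  (forall x, a x <-> b x) -> deg1 eta a n -> deg1 eta b n.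
Proof.
move=> ab [n_gt0 an ker sur]; split=> //; first by apply/ab.
  by move=> m /ab /ker.
by move=> x /sur[m am]; exists m; apply/ab.
Qed.

Lemma prime_ideal_mem_prime (p : L -> Prop) n : prime_ideal eta p ->
  (0 < n)%N -> p n%:R -> exists2 q, prime q & p q%:R.
Proof.
move=> prim_p; elim/ltn_ind: n => n IHn n_gt0 pn.
have [n_le1|n_gt1] := leqP n 1.
  have En : n = 1%N by apply/eqP; rewrite eqn_leq n_le1.
  by have [_ _ p1 _] := prim_p; case: p1; rewrite En in pn.
have [m Em] := dvdnP (pdiv_dvd n).
have m_gt0 : (0 < m)%N by move: n_gt0; rewrite {1}Em muln_gt0 => /andP[].
have ltmn : (m < n)%N.
  by rewrite {1}Em ltn_Pmulr // prime_gt1 // pdiv_prime.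
have [|||pm|pq] := prime_idealP prim_p (x := m%:R) (y := (pdiv n)%:R).
- exact: rpred_nat.
- exact: rpred_nat.
- by rewrite -natrM -Em.
- exact: IHn ltmn m_gt0 pm.
- by exists (pdiv n) => //; apply: pdiv_prime.
Qed.

(** R/p is a quotient of R/a, so Z maps onto it. As n is in p, so is some prime q; an integer in p
    prime to q would put 1 in p. *)
Lemma deg1_prime_above (a p : L -> Prop) n : prime_ideal eta p ->
  deg1 eta a n -> (forall x, a x -> p x) -> exists q, deg1 eta p q.
Proof.
move=> prim_p [n_gt0 an _ sur] ap; have [ip _ p1 _] := prim_p.
have [q pr_q pq] := prime_ideal_mem_prime prim_p n_gt0 (ap _ an).
exists q; split=> //; first exact: prime_gt0.
  move=> m pm; apply/negPn/negP => qm; apply: p1.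
  have /bezout_int[s [t st]] : coprimez q%:Z m.
    by rewrite coprimezE /= prime_coprime.
  have <- : s%:~R * q%:R + t%:~R * m%:~R = 1 :> L.
    by have := congr1 (fun z : int => z%:~R : L) st; rewrite rmorphD !rmorphM.
  by apply: (is_idealD ip); apply: (is_idealMl ip) => //; apply: rpred_int.
by move=> x /sur[m am]; exists m; apply: ap.
Qed.

Lemma ramified_int (p : L -> Prop) (m : int) : is_ideal eta p ->
  ramified eta p -> p m%:~R -> ipow eta p 2 m%:~R.
Proof.
move=> ip [q [_ pZ [d [id dq]]]] pm.
have ip2 := ipow_ideal 2 ip.
have [z Zz ->] : exists2 z, Zeta eta z & m%:~R = q%:R * z :> L.
  by apply/pZ; split=> //; apply: Zeta_int.
apply: (is_idealMr ip2); first exact: Zeta_sub.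
apply: (imul_subl ip2 id); apply/dq; exists 1; last by rewrite mulr1.
by apply/ringRP; apply: rpred1.
Qed.

Hypothesis distinct_ps : forall i j, i != j -> ~ iset_eq (ps i) (ps j).
Hypothesis es_gt0 : forall i, (0 < es i)%N.
Variable a : L -> Prop.
Hypotheses (ia : is_ideal eta a) (a_fact : iset_eq a (iprod eta ps es)).

(** Both claims replace an element of R by an integer congruent to it modulo a, where membership is
    easy to decide. *)
Lemma deg_one_factors : deg_one eta a ->
  (forall i, deg_one eta (ps i) /\ (ramified eta (ps i) -> es i = 1%N)) /\
  (forall i j : 'I_r, (i < j)%N ->
     gcdn (norm eta (ps i)) (norm eta (ps j)) = 1%N).
Proof.
move=> /(deg_oneP eta_gt0 ia)[n da].
have a_pow i x : a x -> ipow eta (ps i) (es i) x.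
  by move/a_fact; apply: foldr_imul_sub; rewrite mem_enum.
have a_ps i x : a x -> ps i x.
  by move=> /a_pow/(ipow_le (ips i) (es_gt0 i))/(ipow1_sub (ips i)).
have dps i : exists q, deg1 eta (ps i) q.
  exact: deg1_prime_above (prim_ps i) da (a_ps i).
have int_mod x : x \in R -> exists m : int, a (x - m%:~R).
  by case: da => _ _ _; apply.
split=> [i|i j ltij].
  have [q dq] := dps i; split; first by apply/(deg_oneP eta_gt0 (ips i)); exists q.
  move=> ram; apply/eqP; rewrite eqn_leq es_gt0 andbT leqNgt; apply/negP => e2.
  (* If e_i were at least 2, x would be congruent modulo p^2 to an integer of p, and these lie in
     p^2 by ramification. *)
  apply: (not_idempotent (prim_ps i) dq) => x px.
  have [m am] := int_mod x (is_ideal_ring (ips i) px).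
  apply: (is_ideal_modr (ipow_ideal 2 (ips i)) (ipow_le (ips i) e2 (a_pow i _ am))).
  apply: ramified_int (ips i) ram _.
  exact: is_ideal_modl (ips i) (a_ps i _ am) px.
have [q dq] := dps i; have [q' dq'] := dps j.
rewrite (deg1_norm eta_gt0 (ips i) dq) (deg1_norm eta_gt0 (ips j) dq').
have pr_q := deg1_residue_prime (prim_ps i) dq.
have pr_q' := deg1_residue_prime (prim_ps j) dq'.
apply/eqP; rewrite -/(coprime _ _) prime_coprime // dvdn_prime2 //.
apply/negP => /eqP Eq; rewrite -{}Eq in dq'.
(* Primes containing a with the same residue characteristic contain the same integers, hence
   coincide. *)
have sub k l : deg1 eta (ps k) q -> deg1 eta (ps l) q ->
    forall x, ps k x -> ps l x.
  move=> dk dl x px; have [m am] := int_mod x (is_ideal_ring (ips k) px).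
  apply: (is_ideal_modr (ips l) (a_ps l _ am)).
  apply/(prime_ideal_int (prim_ps l) dl)/(prime_ideal_int (prim_ps k) dk).
  exact: is_ideal_modl (ips k) (a_ps k _ am) px.
apply: (@distinct_ps i j); first by rewrite neq_ltn ltij.
by move=> x; split; apply: sub.
Qed.

Lemma deg_one_of_factors :
  (forall i, deg_one eta (ps i) /\ (ramified eta (ps i) -> es i = 1%N)) ->
  (forall i j : 'I_r, (i < j)%N ->
     gcdn (norm eta (ps i)) (norm eta (ps j)) = 1%N) ->
  deg_one eta a.
Proof.
move=> d1 cop; apply/(deg_oneP eta_gt0 ia).
exists (\prod_(i <- enum 'I_r) norm eta (ps i) ^ es i)%N.
apply: (deg1_ext (fun x => iff_sym (a_fact x))); apply: deg1_foldr_imul.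
- exact: enum_uniq.
- move=> i; have [di ei] := d1 i.
  apply: (deg1_ipow eta_gt0 (prim_ps i) (deg_one_norm eta_gt0 (ips i) di)).
  by case: (classic (ramified eta (ps i))) => [/ei|]; [right | left].
- move=> i j; rewrite neq_ltn => /orP[] /cop; first by move/eqP.
  by rewrite coprime_sym => /eqP.
Qed.

End Factorization.

(** * Roots of f modulo n *)

Section LocalizedAlgebraicIntegers.
Variable eta : nat.

(** The algebraic integers with eta inverted, where the conjugates of elements of R live. *)
Definition Aloc : {pred algC} := fun z =>
  if excluded_middle_informative (exists k, (eta%:R : algC) ^+ k * z \in Aint)
  then true else false.

Lemma AlocP z : reflect (exists k, (eta%:R : algC) ^+ k * z \in Aint) (z \in Aloc).
Proof.
rewrite unfold_in /Aloc; case: excluded_middle_informative => h; first by left.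
by right.
Qed.

Lemma Aint_etaX k : (eta%:R : algC) ^+ k \in Aint.
Proof. by rewrite rpredX // rpred_nat. Qed.

Lemma Aloc_subring : subring_closed Aloc.
Proof.
split=> [|x y /AlocP[k kx] /AlocP[j jy]|x y /AlocP[k kx] /AlocP[j jy]];
  apply/AlocP.
- by exists 0%N; rewrite mul1r rpred1.
- exists (k + j)%N; rewrite mulrBr rpredB //.
    by rewrite addnC exprD -mulrA rpredM // Aint_etaX.
  by rewrite exprD -mulrA rpredM // Aint_etaX.
- by exists (k + j)%N; rewrite exprD mulrACA rpredM.
Qed.

HB.instance Definition _ := GRing.isSubringClosed.Build algC Aloc Aloc_subring.

(** A rational algebraic integer is an integer, and one power of eta serves all the coefficients. *)
Lemma rat_poly_Aloc (G : {poly rat}) : map_poly ratr G \is a polyOver Aloc ->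
  exists K (g : {poly int}), map_poly intr g = (eta%:R : rat) ^+ K *: G.
Proof.
move=> /polyOverP GA.
have [K KG] : exists K, forall i, (i < size G)%N ->
    (eta%:R : rat) ^+ K * G`_i \is a Num.int.
  elim: (size G) => [|n [K KG]]; first by exists 0%N.
  have /AlocP[k kG] := GA n; rewrite coef_map /= in kG.
  have {}kG : (eta%:R : rat) ^+ k * G`_n \is a Num.int.
    have E : ratr (eta%:R ^+ k * G`_n) = (eta%:R : algC) ^+ k * ratr G`_n.
      by rewrite rmorphM rmorphXn /= ratr_nat.
    rewrite -E in kG.
    have /intrP[m Em] := Cint_rat_Aint (Crat_rat _) kG.
    by apply/intrP; exists m; apply: (fmorph_inj (ratr : {rmorphism rat -> algC}));
      rewrite /= Em ratr_int.
  exists (k + K)%N => i; rewrite ltnS leq_eqVlt => /predU1P[->|lti].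
    by rewrite addnC exprD -mulrA rpredM ?rpredX ?rpred_nat.
  by rewrite exprD -mulrA rpredM ?rpredX ?rpred_nat ?KG.
exists K, (\poly_(i < size G) numq (eta%:R ^+ K * G`_i)).
apply/polyP => i; rewrite coef_map coefZ coef_poly /=; case: ltnP => [lti|lei].
  by rewrite numqK ?KG.
by rewrite nth_default ?mulr0.
Qed.

(* g is the Lagrange form sum_r P(r) F/(X - r), F the product of the X - r. *)
Lemma lagrange_deriv (A : comNzRingType) (S : subringClosed A) (P : {poly A})
    (rs : seq A) :
  {in rs, forall r, r \in S /\ P.[r] \in S} ->
  let F := \prod_(r <- rs) ('X - r%:P) in
  exists g h : {poly A}, [/\ (size g <= size rs)%N, g \is a polyOver S &
    P * F^`() = g + h * F].
Proof.
elim: rs => [|r rs IHrs] Srs F.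
  by exists 0, 0; rewrite /F big_nil size_poly0 rpred0 derivC mulr0 mul0r addr0.
have [|g [h [sz_g Sg Eg]]] := IHrs; first by move=> s rss; apply: Srs; rewrite inE rss orbT.
have [Sr SPr] := Srs r (mem_head _ _).
have SrsX : \prod_(s <- rs) ('X - s%:P) \is a polyOver S.
  rewrite big_seq; apply: rpred_prod => s rss.
  by rewrite polyOverXsubC; have [] : s \in S /\ P.[s] \in S
    by apply: Srs; rewrite inE rss orbT.
(* In P F' = P F1 + (X - r) P F1', this replaces P F1 by P(r) F1 + u F. *)
have [u Eu] : exists u, P - (P.[r])%:P = u * ('X - r%:P).
  by apply/factor_theorem/rootP; rewrite !hornerE subrr.
rewrite /F big_cons derivM derivXsubC mul1r.
set F1 := \prod_(s <- rs) _ in Eg SrsX *.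
exists (P.[r] *: F1 + ('X - r%:P) * g), (u + h); split.
- rewrite (leq_trans (size_polyD _ _)) // geq_max.
  rewrite (leq_trans (size_scale_leq _ _)) ?size_prod_XsubC //=.
  by rewrite (leq_trans (size_polyMleq _ _)) // size_XsubC.
- by rewrite rpredD ?polyOverZ // rpredM // polyOverXsubC.
rewrite mulrDr [P * (_ * _)]mulrCA Eg -{1}[P](subrK (P.[r])%:P) Eu -mul_polyC.
ring.
Qed.

End LocalizedAlgebraicIntegers.

(** The last column of the Sylvester matrix contains only leading coefficients of f and f' and
    zeros, all multiples of that of f. So the division in [disc] is exact. *)
Lemma lead_coef_dvd_resultant (f : {poly int}) : (1 < size f)%N ->
  (lead_coef f %| resultant f f^`())%Z.
Proof.
have aux (k a b : nat) : (k < a)%N -> (b <= (a + b).-1 - k)%N by lia.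
have aux' (k a b : nat) : (k < b)%N -> (a <= (a + b).-1 - k)%N by lia.
move=> sz_f; set c := lead_coef f.
have sz_f' : ((size f).-1 <= size f^`())%N.
  rewrite leqNgt; apply/negP => lt_f'.
  have : f^`()`_(size f).-2 = 0.
    by rewrite nth_default // -ltnS prednK // -ltnS prednK // ltnW.
  rewrite coef_deriv; have -> : (size f).-2.+1 = (size f).-1.
    by rewrite prednK // -ltnS prednK // ltnW.
  rewrite -lead_coefE => /eqP; rewrite mulrn_eq0 lead_coef_eq0.
  by rewrite -size_poly_eq0; case: (size f) sz_f => [|[|]].
have f_top t : ((size f).-1 <= t)%N -> (c %| f`_t)%Z.
  rewrite leq_eqVlt => /predU1P[<-|ltt]; first by rewrite -lead_coefE.
  by rewrite nth_default ?dvdz0 //; case: (size f) ltt.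
have f'_top t : ((size f^`()).-1 <= t)%N -> (c %| f^`()`_t)%Z.
  move=> let_; rewrite coef_deriv -mulr_natr dvdz_mulr // f_top //.
  by case: (size f^`()) sz_f' let_ => [|m] h1 h2;
    rewrite (leq_trans h1).
rewrite /resultant; set A := Sylvester_mx _ _.
have dS : (0 < (size f^`()).-1 + (size f).-1)%N.
  by rewrite addn_gt0 orbC; case: (size f) sz_f => [|[|]].
have lt_last : (((size f^`()).-1 + (size f).-1).-1 < (size f^`()).-1 + (size f).-1)%N.
  by rewrite ltn_predL.
rewrite (expand_det_col _ (Ordinal lt_last)); apply: rpred_sum => i _.
rewrite dvdz_mulr // Sylvester_mxE /=.
case: splitP => k _; (case: leqP => lek; last by rewrite dvdz0); rewrite mulr1n.
  exact/f_top/aux.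
exact/f'_top/aux'.
Qed.

Lemma minPoly_rat (L : fieldExtType rat) (alpha : L) : exists2 M : {poly rat},
  minPoly 1%VS alpha = map_poly (in_alg L) M & M \is monic.
Proof.
have /polyOver1P[M EM] := minPolyOver 1%AS alpha.
by exists M => //; rewrite -(map_monic (in_alg L)) -EM monic_minPoly.
Qed.

Lemma horner_sub_dvd (A : comNzRingType) (p : {poly A}) (v : A) :
  exists q, p - (p.[v])%:P = q * ('X - v%:P).
Proof. by apply/factor_theorem/rootP; rewrite !hornerE subrr. Qed.

(** * Comparison of R with Z[alpha] modulo n *)

Section MonogenicReduction.
Variables (L : fieldExtType rat) (eta : nat).
Local Notation R := (@ringR L eta).
Variables (alpha : L) (f : {poly int}) (M : {poly rat}).
Local Notation iota := (in_alg L).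
Local Notation ratC := (ratr : rat -> algC).
Hypotheses (R_alpha : alpha \in R) (gen_alpha : <<1%VS; alpha>>%VS = fullv).
Hypothesis prim_f : `|zcontents f| = 1.
Hypothesis minf : map_poly (intr : int -> L) f
  = (lead_coef f)%:~R *: minPoly 1%VS alpha.
Hypotheses (EM : minPoly 1%VS alpha = map_poly iota M) (mon_M : M \is monic).

Definition evZ (g : {poly int}) : L := (map_poly intr g).[alpha].

Lemma evZB g h : evZ (g - h) = evZ g - evZ h.
Proof. by rewrite /evZ rmorphB /= hornerD hornerN. Qed.
Lemma evZD g h : evZ (g + h) = evZ g + evZ h.
Proof. by rewrite /evZ rmorphD /= hornerD. Qed.
Lemma evZM g h : evZ (g * h) = evZ g * evZ h.
Proof. by rewrite /evZ rmorphM /= hornerM. Qed.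
Lemma evZC (m : int) : evZ m%:P = m%:~R.
Proof. by rewrite /evZ map_polyC hornerC. Qed.
Lemma evZX : evZ 'X = alpha.
Proof. by rewrite /evZ map_polyX hornerX. Qed.

Lemma evZ_R g : evZ g \in R.
Proof.
rewrite /evZ horner_poly; apply: rpred_sum => i _.
by rewrite rpredM ?rpred_int ?rpredX.
Qed.

Lemma map_iota_intr (g : {poly int}) :
  map_poly iota (map_poly intr g) = map_poly intr g.
Proof.
by rewrite -map_poly_comp; apply: eq_map_poly => z; apply: (rmorph_int iota).
Qed.

Lemma primitive_neq0 : f != 0.
Proof.
by apply/eqP => f0; move: prim_f; rewrite f0 zcontents0 normr0.
Qed.

Lemma minf_rat : map_poly intr f = (lead_coef f)%:~R *: M.
Proof.
apply: (map_poly_inj iota); rewrite map_iota_intr minf map_polyZ EM.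
by rewrite rmorph_int.
Qed.

Lemma minPoly_rat_dvd (h : {poly rat}) : (map_poly iota h).[alpha] = 0 -> M %| h.
Proof.
move=> h0; rewrite -(dvdp_map iota) -EM minPoly_dvdp //; last exact/rootP.
by apply/polyOver1P; exists h.
Qed.

Lemma evZ_root : evZ f = 0.
Proof.
rewrite /evZ minf hornerZ.
by have /rootP -> := root_minPoly 1%AS alpha; rewrite mulr0.
Qed.

(** Gauss's lemma: divisibility over the rationals by a primitive polynomial descends to Z. Here
    [zprimitive f] is f up to sign. *)
Lemma evZ_eq0_dvd (W : {poly int}) : evZ W = 0 -> exists r, W = zprimitive f * r.
Proof.
move=> W0; have : f %| W.
  rewrite -dvdp_rat_int minf_rat dvdpZl; last first.
    by rewrite intr_eq0 lead_coef_eq0 primitive_neq0.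
  by apply: minPoly_rat_dvd; rewrite map_iota_intr.
by move/dvdpP_int => [r ->]; exists r.
Qed.

Lemma dvdz_zprimitive (n v : int) : (n %| f.[v])%Z -> (n %| (zprimitive f).[v])%Z.
Proof.
rewrite {1}[f]zpolyEprim hornerZ !dvdzE abszM.
have -> : absz (zcontents f) = 1%N by move: prim_f; rewrite -abszE => -[].
by rewrite mul1n.
Qed.

(** An integral equation for eta^k P(alpha), composed with eta^k P, is a multiple of M, so it holds
    at every conjugate r. *)
Lemma conjugate_Aloc (P : {poly rat}) (r : algC) :
  (map_poly iota P).[alpha] \in R -> root (map_poly ratC M) r ->
  (map_poly ratC P).[r] \in Aloc eta.
Proof.
move=> /ringRP[k [g [mon_g g0]]] Mr; apply/AlocP; exists k.
pose H := map_poly intr g \Po ((eta%:R ^+ k) *: P).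
have MH : M %| H.
  apply: minPoly_rat_dvd; rewrite map_comp_poly map_iota_intr horner_comp.
  by rewrite map_polyZ hornerZ rmorphXn rmorph_nat.
apply: (root_monic_Aint (p := map_poly intr g)).
- have : root (map_poly ratC H) r.
    rewrite -!dvdp_XsubCl in Mr *; apply: dvdp_trans Mr _.
    by rewrite dvdp_map.
  rewrite /root map_comp_poly horner_comp map_polyZ hornerZ rmorphXn /= ratr_nat.
  rewrite -map_poly_comp; congr (_.[_] == 0).
  by apply: eq_map_poly => z /=; rewrite ratr_int.
- exact: monic_map.
- by apply/polyOverP => i; rewrite coef_map /= intr_int.
Qed.

Lemma minPoly_roots : exists2 rs : seq algC,
  map_poly ratC M = \prod_(r <- rs) ('X - r%:P) &
  {in rs, forall r, forall P : {poly rat}, (map_poly iota P).[alpha] \in R ->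
    (map_poly ratC P).[r] \in Aloc eta}.
Proof.
have [rs Ers] := closed_field_poly_normal (map_poly ratC M).
have lc1 : lead_coef (map_poly ratC M) = 1.
  by rewrite lead_coef_map (monicP mon_M) rmorph1.
rewrite lc1 scale1r in Ers.
exists rs => // r rrs P RP; apply: conjugate_Aloc => //.
by rewrite Ers root_prod_XsubC.
Qed.

(** The conjugates of alpha are integral up to powers of eta, so some eta^K M is integral. Comparing
    contents with the primitive f gives the divisibility. *)
Lemma lead_coef_dvd_eta : exists K, (lead_coef f %| eta%:Z ^+ K)%Z.
Proof.
have [rs Ers rsA] := minPoly_roots.
have /rat_poly_Aloc[K [g Eg]] : map_poly ratC M \is a polyOver (Aloc eta).
  rewrite Ers big_seq; apply: rpred_prod => r rrs.
  rewrite polyOverXsubC; have := rsA r rrs 'X.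
  by rewrite !map_polyX !hornerX; apply.
have E : lead_coef f *: g = (eta%:Z ^+ K) *: f.
  apply: (map_inj_poly (f := intr : int -> rat)) => //; first exact: intr_inj.
  rewrite !map_polyZ /= Eg minf_rat !scalerA mulrC.
  by rewrite rmorphXn.
exists K; have := congr1 zcontents E; rewrite !zcontentsZ => Ez.
have : (lead_coef f %| eta%:Z ^+ K * zcontents f)%Z by rewrite -Ez dvdz_mulr.
rewrite !dvdzE abszM.
have -> : absz (zcontents f) = 1%N by move: prim_f; rewrite -abszE => -[].
by rewrite muln1.
Qed.

(** For beta = P(alpha), the remainder of P M' modulo M is the Lagrange form over the conjugates.
    Its coefficients are integral up to powers of eta, and its value at alpha is M'(alpha) beta. *)
Lemma deriv_conductor beta : beta \in R -> exists K g,
  evZ g = (eta%:R ^+ K * evZ f^`()) * beta.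
Proof.
move=> Rb.
have [P EP] : exists P, beta = (map_poly iota P).[alpha].
  have : beta \in <<1%VS; alpha>>%VS by rewrite gen_alpha memvf.
  by case/Fadjoin_polyP => p /polyOver1P[P ->] ->; exists P.
have [rs Ers rsA] := minPoly_roots.
have [g [h [sz_g Ag Eg]]] : exists g h : {poly algC}, [/\ (size g <= size rs)%N,
    g \is a polyOver (Aloc eta) & map_poly ratC P * (map_poly ratC M)^`() =
      g + h * map_poly ratC M].
  rewrite Ers; apply: lagrange_deriv => r rrs; split; last by apply: rsA; rewrite -?EP.
  by have := rsA r rrs 'X; rewrite !map_polyX !hornerX; apply.
pose G := (P * M^`()) %% M.
have GE : map_poly ratC G = g.
  rewrite map_modp rmorphM /= -deriv_map Eg addrC modp_addl_mul_small //.
  by rewrite Ers size_prod_XsubC ltnS.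
have /rat_poly_Aloc[K [g0 Eg0]] : map_poly ratC G \is a polyOver (Aloc eta).
  by rewrite GE.
exists K, (lead_coef f *: g0).
have Galpha : (map_poly iota G).[alpha] = beta * (map_poly iota M^`()).[alpha].
  rewrite EP -hornerM -rmorphM /= [P * _](divp_eq _ M) rmorphD rmorphM /=.
  rewrite hornerD hornerM -EM.
  by have /rootP -> := root_minPoly 1%AS alpha; rewrite mulr0 add0r.
have f'alpha : evZ f^`() = (lead_coef f)%:~R * (map_poly iota M^`()).[alpha].
  by rewrite /evZ -!deriv_map minf derivZ hornerZ EM.
rewrite f'alpha /evZ map_polyZ hornerZ -map_iota_intr Eg0 map_polyZ hornerZ.
by rewrite Galpha rmorphXn rmorph_nat; ring.
Qed.

(** The resultant is w(alpha) f'(alpha) because f(alpha) = 0. Up to sign it is the leading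
    coefficient times the discriminant, both prime to n. *)
Lemma conductor n beta : coprime n (eta * `|disc f|) -> beta \in R ->
  exists (D : int) g, coprimez n%:Z D /\ D%:~R * beta = evZ g.
Proof.
rewrite coprimeMr => /andP[cop_eta cop_disc] Rb.
have [K lcK] := lead_coef_dvd_eta.
have cop_etaX j : coprimez n%:Z (eta%:Z ^+ j).
  by rewrite coprimezE abszX coprimeXr.
have cop_lc : coprimez n%:Z (lead_coef f).
  exact: coprimez_dvdr lcK (cop_etaX K).
have sz_f : (1 < size f)%N.
  have <- : size (map_poly (intr : int -> rat) f) = size f.
    by rewrite size_map_inj_poly //; apply: intr_inj.
  rewrite minf_rat size_scale; last by rewrite intr_eq0 lead_coef_eq0 primitive_neq0.
  rewrite -(size_map_poly iota) -EM (root_size_gt1 (a := alpha)) //.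
    by rewrite monic_neq0 // monic_minPoly.
  exact: (root_minPoly 1%AS).
have [w [D0 [cop_D0 ED0]]] : exists w (D0 : int), coprimez n%:Z D0 /\
    evZ w * evZ f^`() = D0%:~R.
  (* For linear f, [resultant_in_ideal] does not apply, but f' is the leading coefficient itself. *)
  have [sz_f'|sz_f'] := leqP (size f^`()) 1.
    exists 1, (lead_coef f); split=> //.
    have sz2 : size f = 2.
      apply/eqP; rewrite eqn_leq sz_f andbT leqNgt; apply/negP => sz3.
      have : f^`()`_(size f).-2 = 0.
        by rewrite nth_default // (leq_trans sz_f') // -ltnS -ltnS; lia.
      rewrite coef_deriv; have -> : (size f).-2.+1 = (size f).-1 by lia.
      move/eqP; rewrite -lead_coefE mulrn_eq0 lead_coef_eq0 (negPf primitive_neq0).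
      by rewrite orbF; lia.
    rewrite -[1]/(1%:P) evZC mul1r (size1_polyC sz_f') evZC coef_deriv.
    by rewrite lead_coefE sz2.
  have [[u w] _ /= E] := resultant_in_ideal sz_f sz_f'.
  exists w, (resultant f f^`()); split; last first.
    by rewrite -evZC E evZD !evZM evZ_root mulr0 add0r.
  have lc_res := lead_coef_dvd_resultant sz_f.
  rewrite -(divzK lc_res) coprimezMr cop_lc andbT.
  by move: cop_disc; rewrite /disc abszM abszX /= exp1n mul1n.
have [j [g Eg]] := deriv_conductor Rb.
exists (D0 * eta%:Z ^+ j), (w * g); split.
  by rewrite coprimezMr cop_D0 cop_etaX.
rewrite evZM Eg rmorphM rmorphXn /= -ED0 -pmulrn; ring.
Qed.

Lemma evZ_mod (v : nat) (n : nat) g :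
  gen2 eta (alpha - v%:R) n%:R (evZ g - (g.[v%:Z])%:~R).
Proof.
have [q Eq] := horner_sub_dvd g v%:Z.
exists (evZ q), 0; split; try exact/ringRP/rpred0; first exact/ringRP/evZ_R.
by rewrite -evZC -evZB Eq evZM evZB evZX evZC mul0r addr0.
Qed.

Section RootsModN.
Variable n : nat.
Hypotheses (n_gt0 : (0 < n)%N) (cop_n : coprime n (eta * `|disc f|)).

Let I v := gen2 eta (alpha - v%:R) (n%:R : L).

Lemma root_ideal v : is_ideal eta (I v).
Proof. by apply: gen2_ideal; rewrite ?rpredB ?rpred_nat. Qed.

(** Multipliers prime to n bring everything into Z[alpha], where the class of g(alpha) is that of
    the integer g(v). *)
Lemma root_ideal_deg1 v : (n%:Z %| f.[v%:Z])%Z -> deg1 eta (I v) n.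
Proof.
move=> fv; have iI := root_ideal v.
have In : I v n%:R.
  exists 0, 1; split; [exact/ringRP/rpred0 | exact/ringRP/rpred1 | ].
  by rewrite mul0r mul1r add0r.
split=> // [m [r [s [/ringRP Rr /ringRP Rs Em]]]|x Rx].
  have [D [g [copD Eg]]] := conductor cop_n Rr.
  have [D' [h [copD' Eh]]] := conductor cop_n Rs.
  (* The equation m = r (alpha - v) + s n, times D D', lifted to Z[x]. As W(alpha) = 0, f divides W,
     and evaluation at v gives n | D D' m. *)
  pose W := (D * D' * m)%:P - (D'%:P * g * ('X - (v%:Z)%:P) + D%:P * h * (n%:Z)%:P).
  have W0 : evZ W = 0.
    rewrite /W evZB evZD !evZM evZB !evZC evZX -Eg -Eh !rmorphM /= Em; ring.
  have [w Ew] := evZ_eq0_dvd W0.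
  have : (n%:Z %| W.[v%:Z])%Z by rewrite Ew hornerM dvdz_mulr // dvdz_zprimitive.
  rewrite /W !hornerE subrr mulr0 add0r => nW.
  have : (n%:Z %| D * D' * m)%Z.
    by rewrite -(subrK (D * h.[v%:Z] * n%:Z) (D * D' * m)) rpredD // dvdz_mull.
  by rewrite Gauss_dvdzr // coprimezMr copD copD'.
have [D [g [copD Eg]]] := conductor cop_n Rx.
have [s [t st]] := bezout_int copD.
have stL : s%:~R * n%:R + t%:~R * D%:~R = 1 :> L.
  by have := congr1 (fun z : int => z%:~R : L) st; rewrite rmorphD !rmorphM.
exists (t * g.[v%:Z]).
have -> : x - (t * g.[v%:Z])%:~R =
    s%:~R * x * n%:R + t%:~R * (evZ g - (g.[v%:Z])%:~R).
  by rewrite -Eg rmorphM /= -{1}[x]mul1r -{1}stL; ring.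
apply: (is_idealD iI); apply: (is_idealMl iI) => //.
- by rewrite rpredM ?rpred_int.
- exact: rpred_int.
- exact: evZ_mod.
Qed.

(** Modulo a, f(v) is congruent to f(alpha) = 0. The ideal (alpha - v, n) lies in a, and both meet Z
    in nZ while Z maps onto both quotients, so they agree. *)
Lemma deg1_root (a : L -> Prop) v : is_ideal eta a -> deg1 eta a n ->
  a (alpha - v%:R) -> (n%:Z %| f.[v%:Z])%Z /\ iset_eq a (I v).
Proof.
move=> ia da av; have [_ an ker _] := da.
have Ia x : I v x -> a x.
  move=> [r [s [/ringRP Rr /ringRP Rs ->]]].
  by apply: (is_idealD ia); apply: (is_idealMl ia).
have fv : (n%:Z %| f.[v%:Z])%Z.
  apply: ker; have := Ia _ (evZ_mod v n f).
  by rewrite evZ_root sub0r => /(is_idealN ia); rewrite opprK.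
split=> // x; split=> [ax|]; last exact: Ia.
have dI := root_ideal_deg1 fv; have [_ _ _ sur] := dI.
have [m Im] := sur x (is_ideal_ring ia ax).
apply: (is_ideal_modr (root_ideal v) Im).
apply: (deg1_dvd (root_ideal v) dI); apply: ker.
exact: is_ideal_modl ia (Ia _ Im) ax.
Qed.

End RootsModN.

End MonogenicReduction.

(** * Residues of alpha and the conclusion *)

Lemma residP (L : fieldExtType rat) eta (eta_gt0 : (0 < eta)%N) (a : L -> Prop) n
    (x : L) : is_ideal eta a -> deg1 eta a n -> x \in ringR eta ->
  (resid eta a x < n)%N /\ a (x - (resid eta a x)%:R).
Proof.
move=> ia da Rx; have [k ltk ak] := deg1_nat ia da Rx.
rewrite -{1}(deg1_norm eta_gt0 ia da).
apply: (epsilon_spec (inhabits 0%N)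
  (fun k : nat => (k < norm eta a)%N /\ a (x - k%:R))).
by exists k; rewrite (deg1_norm eta_gt0 ia da).
Qed.

Lemma resid_unique (L : fieldExtType rat) eta (eta_gt0 : (0 < eta)%N)
    (a : L -> Prop) n (x : L) v : is_ideal eta a -> deg1 eta a n ->
  x \in ringR eta -> (v < n)%N -> a (x - v%:R) -> resid eta a x = v.
Proof.
move=> ia da Rx ltv av; have [ltr ar] := residP eta_gt0 ia da Rx.
have [_ _ ker _] := da; set r := resid _ _ _ in ltr ar *.
have /ker : a ((r%:Z - v%:Z)%:~R).
  have -> : (r%:Z - v%:Z)%:~R = (x - v%:R) - (x - r%:R) by rewrite rmorphB /=; ring.
  exact: is_idealB ia av ar.
rewrite -eqz_mod_dvd => /eqP; rewrite !modz_nat => -[].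
by rewrite !modn_small.
Qed.

Theorem theorem1p1 (L : fieldExtType rat) (eta : nat) (eta_gt0 : (0 < eta)%N) :
  (* Part 1 *)
  (forall (a : L -> Prop), is_ideal eta a -> (exists2 x, a x & x != 0) -> ~ a 1 ->
   forall (r : nat) (ps : 'I_r -> L -> Prop) (es : 'I_r -> nat),
     (forall i, prime_ideal eta (ps i)) ->
     (forall i j, i != j -> ~ iset_eq (ps i) (ps j)) ->
     (forall i, (0 < es i)%N) ->
     iset_eq a (iprod eta ps es) ->
     (deg_one eta a <->
       ((forall i, deg_one eta (ps i) /\ (ramified eta (ps i) -> es i = 1%N)) /\
        (forall i j : 'I_r, (i < j)%N ->
           gcdn (norm eta (ps i)) (norm eta (ps j)) = 1%N)))) /\
  (* Part 2 *)
  (forall (alpha : L), Rloc eta alpha -> <<1%VS; alpha>>%VS = fullv ->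
   forall f : {poly int}, `|zcontents f| = 1 ->
     map_poly (fun z : int => z%:~R : L) f = (lead_coef f)%:~R *: minPoly 1%VS alpha ->
   forall n : nat, (2 <= n)%N -> coprime n (eta * `|disc f|) ->
     (forall v : nat, (v < n)%N -> (n%:Z %| f.[v%:Z])%Z ->
        let a := gen2 eta (alpha - v%:R) n%:R in
        [/\ is_ideal eta a, deg_one eta a, norm eta a = n & resid eta a alpha = v]) /\
     (forall a : L -> Prop, is_ideal eta a -> deg_one eta a -> norm eta a = n ->
        let v := resid eta a alpha in
        [/\ (v < n)%N, (n%:Z %| f.[v%:Z])%Z & iset_eq a (gen2 eta (alpha - v%:R) n%:R)])).
Proof.
split=> [a ia _ _ r ps es prim_ps dist es_gt0 a_fact|].
  split=> [|[]]; first exact: deg_one_factors a_fact.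
  exact: deg_one_of_factors a_fact.
move=> alpha /ringRP Ra gen f prim_f minf n n_ge2 cop.
have n_gt0 : (0 < n)%N by apply: ltnW.
have [M EM mon_M] := minPoly_rat alpha.
split=> [v ltv fv a | a ia da En v].
  have ia : is_ideal eta a := root_ideal Ra n v.
  have da : deg1 eta a n.
    exact: (root_ideal_deg1 Ra gen prim_f minf EM mon_M n_gt0 cop fv).
  split=> //; first by apply/(deg_oneP eta_gt0 ia); exists n.
    exact: deg1_norm.
  apply: resid_unique da _ ltv _ => //.
  exists 1, 0; split; [exact/ringRP/rpred1 | exact/ringRP/rpred0 | ].
  by rewrite mul1r mul0r addr0.
have d1a : deg1 eta a n by rewrite -En; apply: deg_one_norm.
have [ltv av] := residP eta_gt0 ia d1a Ra.
have [fv aI] := deg1_root Ra gen prim_f minf EM mon_M n_gt0 cop ia d1a av.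
by split.
Qed.
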